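(* Let $\varphi(x)=x/\log(e/x)$. There exists a universal constant $c>0$ such that for any $n\ge 1$ and for any two increasing continuously differentiable functions $f,g:\mathbb{R}^n\to[-1,1]$, $$\mathbb{E}_\mu[fg]-\mathbb{E}_\mu[f]\,\mathbb{E}_\mu[g]\ \ge\ c\,\varphi\Big(\sum_{i=1}^n\mathbb{E}_\mu[\partial_i f]\,\mathbb{E}_\mu[\partial_i g]\Big).$$
   Context: $\mu$ is the standard Gaussian measure on $\mathbb{R}$ and $\mathbb{E}_\mu$ denotes integration with respect to the product measure $\mu^{\otimes n}$ on $\mathbb{R}^n$. A function on $\mathbb{R}^n$ is increasing if it is increasing (non-decreasing) in each coordinate. Convention: $\varphi(0)=0$. *)

(* Defs.v *)
From HB Require Import structures.
From mathcomp Require Import all_boot all_order all_algebra.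
From mathcomp Require Import all_classical all_reals all_analysis.

Set Implicit Arguments.
Unset Strict Implicit.
Unset Printing Implicit Defensive.

Import Order.TTheory GRing.Theory Num.Theory.
Import numFieldNormedType.Exports.

Local Open Scope classical_set_scope.
Local Open Scope ring_scope.

Section power_probability.
Context d (T : measurableType d) (R : realType) (P : probability T R).

Definition tuple_cons n (x : T * n.-tuple T) : n.+1.-tuple T :=
  [the n.+1.-tuple T of x.1 :: x.2].

Lemma measurable_tuple_cons n : measurable_fun [set: _] (@tuple_cons n).
Proof. exact: measurable_cons. Qed.

HB.instance Definition _ n :=
  @isMeasurableFun.Build _ _ _ _ (@tuple_cons n) (@measurable_tuple_cons n).

(* The n-fold product P \x ... \x P, carried by n.-tuple T with its product
   sigma-algebra: the image of P \x P^(n) under (x, t) |-> x :: t. *)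
Fixpoint power_probability n : probability (n.-tuple T) R :=
  match n with
  | 0 => dirac [tuple]
  | m.+1 => distribution (P \x power_probability m)%E (@tuple_cons m)
  end.

Lemma power_probability_box n (A : 'I_n -> set T) :
  (forall i, measurable (A i)) ->
  power_probability n [set t | forall i, A i (tnth t i)] =
  (\prod_(i < n) P (A i))%E.
Proof.
elim: n A => [|n IH] A mA.
  rewrite big_ord0 /= diracE (_ : _ \in _ = true)//.
  by apply/mem_set => -[].
rewrite big_ord_recl /= /distribution /pushforward.
have mbox : measurable
    [set t : n.-tuple T | forall i, A (lift ord0 i) (tnth t i)].
  rewrite (_ : mkset _ =
      \bigcap_(i in [set: 'I_n]) ((@tnth n T) ^~ i @^-1` A (lift ord0 i))).
    apply: fin_bigcap_measurable => // i _.
    rewrite -[X in measurable X]setTI.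
    by apply: measurable_tnth.
  by apply/seteqP; split=> [t tA i _|t tA i]; [exact: tA|exact: (tA i)].
rewrite (_ : _ @^-1` _ =
    A ord0 `*` [set t : n.-tuple T | forall i, A (lift ord0 i) (tnth t i)]).
  rewrite product_measure1E//.
  by congr (_ * _)%E; apply: (IH (fun i => A (lift ord0 i))).
apply/seteqP; split=> [[x t] /= xtA|[x t] /= [Ax At] i].
  split=> [|i]; first exact: (xtA ord0).
  by have := xtA (lift ord0 i); rewrite tnthS.
by case: (unliftP ord0 i) => [j ->|->//]; rewrite tnthS.
Qed.

End power_probability.

Section gauss_space.
Context (R : realType).

Definition gauss_expectation n (h : 'rV[R]_n -> R) : R :=
  \int[power_probability (normal_prob (0 : R) 1) n]_t h (\row_i tnth t i).

Definition partial n (i : 'I_n) (f : 'rV[R]_n -> R) : 'rV[R]_n -> R :=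
  'D_(delta_mx 0 i) f.

Definition continuously_differentiable n (f : 'rV[R]_n -> R) :=
  (forall x, differentiable f x) /\ (forall i, continuous (partial i f)).

Definition coordinatewise_nondecreasing n (f : 'rV[R]_n -> R) :=
  forall (i : 'I_n) (x y : 'rV[R]_n),
    (forall j, j != i -> x 0 j = y 0 j) -> x 0 i <= y 0 i -> f x <= f y.

(* Only evaluated on [0, 1]: for monotone f, g with values in [-1, 1],
   E[d_i f] = E[x_i f] >= 0 and Bessel's inequality bounds
   sum_i E[d_i f] E[d_i g] by 1, so ln (e / x) >= 1 whenever x != 0. *)
Definition phi (x : R) : R := if x == 0 then 0 else x / ln (expR 1 / x).

End gauss_space.

(* Main.v *)
Require Import Defs.
From mathcomp Require Import all_boot all_order all_algebra.
From mathcomp Require Import all_classical all_reals all_analysis.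
From mathcomp Require Import perm measurable_realfun.
From mathcomp Require Import zify ring lra.

Set Implicit Arguments.
Unset Strict Implicit.
Unset Printing Implicit Defensive.

Import Order.TTheory GRing.Theory Num.Theory.
Import numFieldNormedType.Exports.

Local Open Scope ring_scope.

(** The inequality is proved first for functions of many fair coin flips and
then carried to Gaussian space by the de Moivre-Laplace theorem.

On the cube, let F and G be increasing with values in [-1, 1], with Fourier
coefficients F^(S), G^(S), and let W = sum_t F^({t}) G^({t}). Choose a random
set B of r coordinates, share the flips in B between two copies of the input
and draw the other flips independently. The mean of F times G under this coupling
is the average k_r of sum_(S inside B) F^(S) G^(S). It runs from
E F * E G at r = 0 to E [F G] at r = #|T|, and its increments are, up to the
factor #|T| - r, the averages w_r of the quantity W for the functions F, G with
the coordinates in B frozen ([Ex_fourier_merge]). These are nonnegative because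
F and G are increasing, and w_0 = W. In the same way the increments of w_r are
governed by second-order coefficients, which the level-2 inequality
[level2_le] bounds by -C (log (e / W) w_r + W log (e / W)). So w_r decays
slowly: it stays above W / 2 as long as r is at most #|T| / (C log (e / W)),
and adding these increments gives E [F G] - E F * E G >= c W / log (e / W)
([slow_decay_growth], [cube_correlation]).

The level-2 inequality is a duality argument. The derivative D_t F is
nonnegative, so in a sum of the E [D_t F * l_t] with linear forms l_t one may
replace l_t by the upper bound (multiple of lambda) + (small exponential). The
first part gives first-order coefficients only. In the second part D_t can be
moved onto the exponentials by summation by parts, and the result has small
second moment ([sum_cube_partial_linear_le]). Applying this once to F and
once to G turns the second-order sum into lambda ^ 2 * W plus an error of order
lambda * exp (- lambda ^ 2), and lambda ^ 2 = log (e / W) balances the two.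

For the transfer, each Gaussian coordinate is replaced by the normalised sum of
4 M ^ 2 flips; its values (j - 2 M ^ 2) / M form a grid of mesh 1 / M.
Expectations over the flips are Gaussian integrals of step functions, weighted by the ratio of
binomial to Gaussian mass of each cell, and this ratio tends to 1 pointwise
([cvg_density_ratio]). Fatou's lemma is then all that is needed: used for 1 + h
and 1 - h it shows that expectations of bounded continuous functions converge,
and used for the nonnegative difference quotients of f it shows that the
Gaussian mean of the partial derivative is at most the liminf of the
first-order coefficients. As x / log (e / x) is increasing on [0, 1], this is
the direction in which the lower bound passes to the limit. *)

(** * Functions of independent fair coin flips *)

Section cube.
Context {R : realType} {T : finType}.
Local Notation cube := {ffun T -> bool}.
Implicit Types (F G h : cube -> R) (x y z : cube) (s t : T) (S U B : {set T}).

Lemma sum_cauchy_schwarz (I : finType) (f g : I -> R) :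
  (\sum_i f i * g i) ^+ 2 <= (\sum_i f i ^+ 2) * (\sum_i g i ^+ 2).
Proof.
have : 0 <= \sum_i \sum_j (f i * g j - f j * g i) ^+ 2.
  by apply: sumr_ge0 => i _; apply: sumr_ge0 => j _; exact: sqr_ge0.
have -> : \sum_i \sum_j (f i * g j - f j * g i) ^+ 2 =
    \sum_i \sum_j (f i ^+ 2 * g j ^+ 2) + \sum_i \sum_j (f j ^+ 2 * g i ^+ 2)
    - 2 * \sum_i \sum_j ((f i * g i) * (f j * g j)).
  rewrite mulr_sumr -sumrN -!big_split/=; apply: eq_bigr => i _.
  rewrite mulr_sumr -sumrN -!big_split/=; apply: eq_bigr => j _; ring.
rewrite [X in _ + X - _]exchange_big/=.
rewrite -!big_distrlr/= -expr2; lra.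
Qed.

Definition sgn (b : bool) : R := if b then 1 else -1.
Definition flip t x : cube := [ffun u => if u == t then ~~ x u else x u].
(** The flips in [B] are frozen to the values of [z]. *)
Definition merge B z x : cube := [ffun t => if t \in B then z t else x t].
Definition Ex F : R := (2 ^+ #|T|)^-1 * \sum_x F x.

Lemma sgnN b : sgn (~~ b) = - sgn b.
Proof. by case: b; rewrite /= ?opprK. Qed.

Lemma sgn_sqr b : sgn b * sgn b = 1.
Proof. by case: b; rewrite /= ?mulrNN mulr1. Qed.

Lemma flipK t : involutive (flip t).
Proof.
by move=> x; apply/ffunP => u; rewrite !ffunE; case: eqP => //; rewrite negbK.
Qed.

Lemma flipE t x : flip t x t = ~~ x t.
Proof. by rewrite ffunE eqxx. Qed.

Lemma flip_neq s t x : s != t -> flip t x s = x s.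
Proof. by rewrite ffunE => /negbTE ->. Qed.

Lemma flipC s t x : flip s (flip t x) = flip t (flip s x).
Proof. by apply/ffunP => u; rewrite !ffunE; case: eqP; case: eqP. Qed.

Lemma card_cube_gt0 : 0 < (2 ^+ #|T|)^-1 :> R.
Proof. by rewrite invr_gt0 exprn_gt0. Qed.

Lemma eq_Ex F G : F =1 G -> Ex F = Ex G.
Proof. by move=> FG; rewrite /Ex; congr (_ * _); apply: eq_bigr. Qed.

Lemma ExD F G : Ex (fun x => F x + G x) = Ex F + Ex G.
Proof. by rewrite /Ex big_split mulrDr. Qed.

Lemma ExZ a F : Ex (fun x => a * F x) = a * Ex F.
Proof. by rewrite /Ex -mulr_sumr mulrCA. Qed.

Lemma ExN F : Ex (fun x => - F x) = - Ex F.
Proof. by rewrite /Ex sumrN mulrN. Qed.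

Lemma Ex_sum (I : Type) (r : seq I) (P : pred I) (f : I -> cube -> R) :
  Ex (fun x => \sum_(i <- r | P i) f i x) = \sum_(i <- r | P i) Ex (f i).
Proof. by rewrite /Ex exchange_big/= mulr_sumr. Qed.

Lemma Ex_cst a : Ex (fun=> a) = a.
Proof.
rewrite /Ex sumr_const card_ffun card_bool -[X in _ * X]mulr_natr natrX.
by rewrite mulrCA mulVf ?mulr1// expf_neq0.
Qed.

Lemma le_Ex F G : (forall x, F x <= G x) -> Ex F <= Ex G.
Proof.
by move=> FG; rewrite /Ex ler_wpM2l ?(ltW card_cube_gt0)// ler_sum.
Qed.

Lemma Ex_ge0 F : (forall x, 0 <= F x) -> 0 <= Ex F.
Proof. by move=> F0; rewrite -[leLHS](Ex_cst 0); exact: le_Ex. Qed.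

Lemma Ex_flip t F : Ex (fun x => F (flip t x)) = Ex F.
Proof.
by rewrite /Ex; congr (_ * _); rewrite [RHS](reindex_inj (inv_inj (flipK t))).
Qed.

Lemma Ex_cauchy_schwarz F G :
  (Ex (fun x => F x * G x)) ^+ 2
  <= Ex (fun x => F x ^+ 2) * Ex (fun x => G x ^+ 2).
Proof.
rewrite /Ex exprMn [X in _ <= X]mulrACA -[X in _ <= X * _]expr2.
by apply: ler_wpM2l (sum_cauchy_schwarz _ _); exact: sqr_ge0.
Qed.

Lemma Ex_exp_linear (v : T -> R) :
  Ex (fun x => expR (\sum_t v t * sgn (x t))) =
  \prod_t ((expR (v t) + expR (- v t)) / 2).
Proof.
rewrite /Ex.
rewrite (eq_bigr (fun x : cube => \prod_t expR (v t * sgn (x t)))); last first.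
  by move=> x _; rewrite expR_sum.
rewrite -(bigA_distr_bigA (fun t b => expR (v t * sgn b)))/=.
rewrite -prodr_const -prodfV -big_split/=; apply: eq_bigr => t _.
by rewrite big_bool/= mulr1 mulrN1 mulrC.
Qed.

Definition walsh S x : R := \prod_(t in S) sgn (x t).
Definition fourier F S : R := Ex (fun x => F x * walsh S x).

Lemma walsh0 x : walsh finset.set0 x = 1.
Proof. by rewrite /walsh big_set0. Qed.

Lemma walsh1 t x : walsh [set t]%SET x = sgn (x t).
Proof. by rewrite /walsh big_set1. Qed.

Lemma walsh2 s t x : s != t -> walsh [set s; t]%SET x = sgn (x s) * sgn (x t).
Proof. by move=> st; rewrite /walsh big_setU1 ?inE//= big_set1. Qed.

Lemma walsh_sqr S x : walsh S x * walsh S x = 1.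
Proof. by rewrite -big_split big1// => t _; exact: sgn_sqr. Qed.

Lemma walsh_flip_in S t x : t \in S -> walsh S (flip t x) = - walsh S x.
Proof.
move=> tS; rewrite /walsh (bigD1 t)//= [in RHS](bigD1 t)//= flipE sgnN mulNr.
by congr (- (_ * _)); apply: eq_bigr => u /andP[_ ut]; rewrite flip_neq.
Qed.

Lemma walsh_flip_notin S t x : t \notin S -> walsh S (flip t x) = walsh S x.
Proof.
move=> tS; apply: eq_bigr => u uS; rewrite flip_neq//.
by apply: contraNneq tS => <-.
Qed.

Lemma walsh_merge B S z x :
  walsh S (merge B z x) = walsh (S :&: B)%SET z * walsh (S :\: B)%SET x.
Proof.
rewrite /walsh (big_setID B)/=; congr (_ * _); apply: eq_bigr => t;
  by rewrite !inE ffunE => /andP[]; case: ifP.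
Qed.

Lemma walsh_orthonormal S U :
  Ex (fun x => walsh S x * walsh U x) = (S == U)%:R.
Proof.
have [->|SU] := eqVneq S U; first by under eq_Ex do rewrite walsh_sqr; rewrite Ex_cst.
have [t tSU] : exists t, (t \in S) != (t \in U).
  apply/existsP; apply: contraNT SU; rewrite negb_exists => /forallP SU.
  by apply/eqP/setP => t; have := SU t; rewrite negbK => /eqP.
have : Ex (fun x => walsh S x * walsh U x) = - Ex (fun x => walsh S x * walsh U x).
  rewrite -[LHS](Ex_flip t) -ExN; apply: eq_Ex => x; move: tSU.
  have [tS|tS] := boolP (t \in S); have [tU|tU] := boolP (t \in U) => // _.
    by rewrite walsh_flip_in// (walsh_flip_notin _ tU) mulNr.
  by rewrite walsh_flip_notin// (walsh_flip_in _ tU) mulrN.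
by move=> /eqP; rewrite -addr_eq0 -mulr2n mulrn_eq0/= => /eqP.
Qed.

(** The Walsh functions are complete because the kernel sum_S walsh S y *
walsh S x factors over the coordinates as prod_t (1 + y_t x_t), which vanishes
unless y = x. *)
Lemma walsh_inversion F x : F x = \sum_S fourier F S * walsh S x.
Proof.
have complete y : \sum_S walsh S y * walsh S x = 2 ^+ #|T| * (y == x)%:R.
  have -> : \sum_S walsh S y * walsh S x = \prod_t (sgn (y t) * sgn (x t) + 1).
    rewrite bigA_distr/=; apply: eq_bigr => S _.
    rewrite /walsh -big_split/= [RHS](bigID [in S])/= [X in _ * X]big1 ?mulr1.
      by apply: eq_bigr => t ->.
    by move=> t /negbTE ->.
  have [->|yx] := eqVneq y x.
    under eq_bigr do rewrite sgn_sqr.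
    by rewrite mulr1 -prodr_const.
  have [t yxt] : exists t, y t != x t.
    apply/existsP; apply: contraNT yx; rewrite negb_exists => /forallP yx.
    by apply/eqP/ffunP => t; have := yx t; rewrite negbK => /eqP.
  rewrite mulr0 (bigD1 t)//=; move: yxt.
  by case: (y t); case: (x t) => //= _; rewrite ?mulrN ?mulr1 addNr mul0r.
rewrite /fourier.
under eq_bigr do rewrite -mulrA mulr_suml mulr_sumr.
rewrite exchange_big/=.
under eq_bigr => y _.
  under eq_bigr do rewrite -mulrA.
  rewrite -mulr_sumr -mulr_sumr complete mulrCA.
  rewrite mulKf ?expf_neq0//.
  over.
rewrite (bigD1 x)//= eqxx mulr1 big1 ?addr0// => y /negbTE ->.
by rewrite mulr0.
Qed.

Lemma parseval F G :
  Ex (fun x => F x * G x) = \sum_S fourier F S * fourier G S.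
Proof.
rewrite [LHS](@eq_Ex _ (fun x => \sum_S fourier F S * (G x * walsh S x))).
  by rewrite Ex_sum; apply: eq_bigr => S _; rewrite ExZ.
move=> x; rewrite mulrC [X in _ * X = _]walsh_inversion mulr_sumr.
by apply: eq_bigr => S _; rewrite mulrCA.
Qed.

Lemma fourier_merge B F z U :
  fourier (fun x => F (merge B z x)) U =
  \sum_(S | (S :\: B)%SET == U) fourier F S * walsh (S :&: B)%SET z.
Proof.
rewrite [LHS](@eq_Ex _ (fun x => \sum_S fourier F S * walsh (S :&: B)%SET z *
    (walsh (S :\: B)%SET x * walsh U x))); last first.
  move=> x; rewrite walsh_inversion mulr_suml; apply: eq_bigr => S _.
  by rewrite walsh_merge !mulrA.
rewrite Ex_sum [RHS]big_mkcond/=; apply: eq_bigr => S _.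
by rewrite ExZ walsh_orthonormal; case: ifP; rewrite ?mulr1 ?mulr0.
Qed.

(** Freezing the coordinates in [B] turns the coefficient of [F] at [U] into a
function of the frozen values whose Walsh coefficients are those of [F] at the
sets [S] with [S] minus [B] equal to [U]. Orthonormality in [z] then leaves the
diagonal. With [U] empty, a singleton or a pair this expresses the coupled
correlation, its first and its second differences through averages of frozen
functions, for which monotonicity and the level-2 inequality are available. *)
Lemma Ex_fourier_merge B F G U :
  Ex (fun z => fourier (fun x => F (merge B z x)) U *
               fourier (fun x => G (merge B z x)) U) =
  \sum_(S | (S :\: B)%SET == U) fourier F S * fourier G S.
Proof.
under eq_Ex => z do rewrite !fourier_merge big_distrlr/=.
rewrite Ex_sum; apply: eq_bigr => S /eqP SB.
rewrite (@eq_Ex _ (fun z => \sum_(V | (V :\: B)%SET == U)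
   (fourier F S * fourier G V) * (walsh (S :&: B)%SET z * walsh (V :&: B)%SET z))); last first.
  by move=> z; apply: eq_bigr => V _; rewrite mulrACA.
rewrite Ex_sum (bigD1 S)/= ?SB//.
rewrite ExZ walsh_orthonormal eqxx mulr1 big1 ?addr0// => V /andP[/eqP VB VS].
rewrite ExZ walsh_orthonormal; case: eqP => [SVB|]; last by rewrite mulr0.
by move: VS; rewrite -(finset.setID V B) -(finset.setID S B) VB SB SVB eqxx.
Qed.

(** Half the difference between the values with flip [t] set to true and to
false; it does not depend on that flip, and it is nonnegative for all [t]
exactly when [F] is increasing. *)
Definition cube_partial t F x : R := sgn (x t) * (F x - F (flip t x)) / 2.

Lemma cube_partial_flip s t F x : (forall y, F (flip s y) = F y) -> s != t ->
  cube_partial t F (flip s x) = cube_partial t F x.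
Proof. by move=> Fs st; rewrite /cube_partial flipC !Fs flip_neq// eq_sym. Qed.

(** Discrete integration by parts: the sign of flip [t] averages the values on
both sides of [t] with opposite signs. *)
Lemma Ex_cube_partial t F h : (forall x, h (flip t x) = h x) ->
  Ex (fun x => cube_partial t F x * h x) = Ex (fun x => F x * (sgn (x t) * h x)).
Proof.
move=> ht; rewrite [LHS](@eq_Ex _ (fun x => 2^-1 * (F x * (sgn (x t) * h x)) +
    2^-1 * (F (flip t x) * (sgn (flip t x t) * h (flip t x))))); last first.
  by move=> x; rewrite /cube_partial flipE sgnN ht; ring.
rewrite ExD !ExZ (Ex_flip t (fun x => F x * (sgn (x t) * h x))).
lra.
Qed.

Lemma fourier_point t F : fourier F [set t]%SET = Ex (cube_partial t F).
Proof.
rewrite [RHS](@eq_Ex _ (fun x => cube_partial t F x * 1)); last first.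
  by move=> x; rewrite mulr1.
rewrite (Ex_cube_partial F (h := fun=> 1))//.
by apply: eq_Ex => x; rewrite walsh1 mulr1.
Qed.

Definition linear_form (v : T -> R) x : R := \sum_s v s * sgn (x s).

Lemma linear_form_flip v t x :
  linear_form v (flip t x) = linear_form v x - 2 * v t * sgn (x t).
Proof.
rewrite /linear_form (bigD1 t)//= [in RHS](bigD1 t)//= flipE sgnN.
rewrite (eq_bigr (fun s => v s * sgn (x s))); last first.
  by move=> s st; rewrite flip_neq.
ring.
Qed.

(** Sub-Gaussian bound for one random sign. For u <= 1/2 it follows from
exp (-u) >= 1 - u applied to both signs, for u >= 1/2 from u <= 2 u ^ 2. *)
Lemma average_exp_le (u : R) : (expR u + expR (- u)) / 2 <= expR (2 * u ^+ 2).
Proof.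
wlog u0 : u / 0 <= u => [ih|].
  have [|u0] := leP 0 u; first exact: ih.
  by have := ih (- u); rewrite opprK sqrrN addrC; apply; lra.
have [u2|u2] := leP (2^-1) u.
  have u2u : u <= 2 * u ^+ 2.
    by have := mulr_ge0 u0 (_ : 0 <= u - 2^-1); rewrite subr_ge0 => /(_ u2); lra.
  have h1 : expR u <= expR (2 * u ^+ 2) by rewrite ler_expR.
  have h2 : expR (- u) <= expR (2 * u ^+ 2) by rewrite ler_expR; lra.
  lra.
have h1 : expR u <= (1 - u)^-1.
  by rewrite -[u]opprK expRN opprK lef_pV2 ?posrE ?expR_gt0 ?expR_ge1Dx//; lra.
have h2 : expR (- u) <= (1 + u)^-1.
  by rewrite expRN lef_pV2 ?posrE ?expR_gt0 ?expR_ge1Dx//; lra.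
have h3 := expR_ge1Dx (2 * u ^+ 2).
have h4 : ((1 - u)^-1 + (1 + u)^-1) / 2 = (1 - u ^+ 2)^-1 by field; apply/and3P; split; nra.
have h5 : (1 - u ^+ 2)^-1 <= 1 + 2 * u ^+ 2.
  rewrite -[leRHS]invrK lef_pV2 ?posrE ?invr_gt0; [|nra|nra].
  rewrite -[leLHS]mul1r ler_pdivrMr; last by nra.
  have : 0 <= u ^+ 2 * (1 - 2 * u ^+ 2) by rewrite mulr_ge0 ?sqr_ge0//; nra.
  lra.
lra.
Qed.

Lemma exp_lipschitz (a b : R) :
  (expR a - expR b) ^+ 2 <= 2 * (a - b) ^+ 2 * (expR a ^+ 2 + expR b ^+ 2).
Proof.
wlog ab : a b / b <= a => [ih|].
  have [|/ltW ab] := leP b a; first exact: ih.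
  by have := ih _ _ ab; lra.
have a0 := expR_gt0 a; have b0 := expR_gt0 b.
have h1 : expR a - expR b <= (a - b) * expR a.
  have := expR_ge1Dx (b - a).
  rewrite expRD expRN -(ler_pM2r a0) mulfVK ?gt_eqF//; lra.
have h2 : expR b <= expR a by rewrite ler_expR.
have h3 : (expR a - expR b) ^+ 2 <= ((a - b) * expR a) ^+ 2.
  by rewrite ler_sqr ?nnegrE//; nra.
apply: le_trans h3 _; rewrite exprMn.
have : 0 <= (a - b) ^+ 2 * (expR a ^+ 2) by rewrite mulr_ge0 ?sqr_ge0.
have : 0 <= (a - b) ^+ 2 * (expR b ^+ 2) by rewrite mulr_ge0 ?sqr_ge0.
nra.
Qed.

End cube.

(** * Linear forms tested against nonnegative derivatives *)

Section linear_test.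
Context {R : realType} {T : finType}.
Local Notation cube := {ffun T -> bool}.
Implicit Types (F G h : cube -> R) (x y z : cube) (s t : T) (S U B : {set T}).

Definition exp_weight (c l : R) (u : T -> R) x : R := c * expR (l * linear_form u x).

Lemma exp_weight_flip c l u t x : u t = 0 ->
  exp_weight c l u (flip t x) = exp_weight c l u x.
Proof. by move=> ut; rewrite /exp_weight linear_form_flip ut mulr0 mul0r subr0. Qed.

Lemma Ex_exp_weight_sqr c l u : \sum_s u s ^+ 2 <= 1 ->
  Ex (fun x : cube => exp_weight c l u x ^+ 2) <= c ^+ 2 * expR (8 * l ^+ 2).
Proof.
move=> u1.
rewrite (@eq_Ex _ _ _ (fun x => c ^+ 2 * expR (\sum_s (2 * l * u s) * sgn (x s)))); last first.
  move=> x; rewrite /exp_weight exprMn -expRM_natl; congr (_ * expR _).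
  by rewrite /linear_form !mulr_sumr; apply: eq_bigr => s _; rewrite !mulrA.
rewrite ExZ ler_wpM2l ?sqr_ge0// Ex_exp_linear.
apply: (@le_trans _ _ (\prod_t expR (2 * (2 * l * u t) ^+ 2))).
  by apply: ler_prod => t _; rewrite average_exp_le divr_ge0 ?addr_ge0 ?expR_ge0.
rewrite -expR_sum ler_expR.
rewrite (eq_bigr (fun t => 8 * l ^+ 2 * u t ^+ 2)); last by move=> t _; ring.
by rewrite -mulr_sumr ler_piMr// mulr_ge0 ?sqr_ge0.
Qed.

Lemma Ex_cube_partial_exp_weight_sqr c l u s :
  Ex (fun x : cube => cube_partial s (exp_weight c l u) x ^+ 2) <=
  4 * l ^+ 2 * u s ^+ 2 * Ex (fun x : cube => exp_weight c l u x ^+ 2).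
Proof.
pose p : cube -> R := exp_weight c l u.
apply: (@le_trans _ _ (Ex (fun x => 2 * l ^+ 2 * u s ^+ 2 * (p x ^+ 2) +
   2 * l ^+ 2 * u s ^+ 2 * (p (flip s x) ^+ 2)))); last first.
  by rewrite ExD !ExZ (Ex_flip s (fun x => p x ^+ 2)) -/p; lra.
apply: le_Ex => x.
have := exp_lipschitz (l * linear_form u x) (l * linear_form u (flip s x)).
rewrite [X in (_ - l * X) ^+ 2]linear_form_flip.
rewrite [X in _ <= _ * X ^+ 2 * _ -> _](_ : _ = 2 * l * u s * sgn (x s)); last by ring.
move=> /(ler_wpM2l (sqr_ge0 c)).
rewrite /p /exp_weight /cube_partial.
have := sgn_sqr (R := R) (x s); set e := sgn _ => e2.
set a := expR _; set b := expR _ => h.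
have -> : (e * (c * a - c * b) / 2) ^+ 2 = c ^+ 2 * (a - b) ^+ 2 / 4 * (e * e) by field.
have h' : c ^+ 2 * (2 * (2 * l * u s * e) ^+ 2 * (a ^+ 2 + b ^+ 2)) =
  4 * (2 * l ^+ 2 * u s ^+ 2 * (c * a) ^+ 2 + 2 * l ^+ 2 * u s ^+ 2 * (c * b) ^+ 2) * (e * e).
  by ring.
rewrite h' e2 in h; rewrite e2; lra.
Qed.

(** The sum over [t] of sgn (x t) * p t x is the divergence of the field [p].
In its second moment a cross term can be summed by parts twice, because [p t]
is independent of flip [t]; it becomes the mean of (D_t p_s) * (D_s p_t), and
the arithmetic-geometric inequality leaves only squares of derivatives. *)
Lemma Ex_divergence_sqr_le (p : T -> cube -> R) :
  (forall t x, p t (flip t x) = p t x) ->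
  Ex (fun x => (\sum_t sgn (x t) * p t x) ^+ 2) <=
  \sum_t (Ex (fun x => p t x ^+ 2) + \sum_s Ex (fun x => cube_partial s (p t) x ^+ 2)).
Proof.
move=> pt.
pose q t s := Ex (fun x => cube_partial s (p t) x ^+ 2).
have q0 t s : 0 <= q t s by apply: Ex_ge0 => x; exact: sqr_ge0.
have h s t : Ex (fun x => (sgn (x t) * p t x) * (sgn (x s) * p s x)) <=
    (if s == t then Ex (fun x => p t x ^+ 2) else 0) + 2^-1 * (q t s + q s t).
  have [->|st] := eqVneq s t.
    rewrite (@eq_Ex _ _ _ (fun x => p t x ^+ 2)); last first.
      by move=> x; rewrite mulrACA sgn_sqr mul1r expr2.
    by rewrite lerDl mulr_ge0// addr_ge0.
  rewrite (@eq_Ex _ _ _ (fun x => p t x * (sgn (x s) * (sgn (x t) * p s x)))); last first.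
    by move=> x; ring.
  rewrite (@eq_Ex _ _ _ (fun x => p s x * (sgn (x t) * (sgn (x s) * p t x)))); last first.
    by move=> x; ring.
  rewrite -Ex_cube_partial; last first.
    by move=> x; rewrite flip_neq// pt.
  rewrite (@eq_Ex _ _ _ (fun x => p t x * (sgn (x s) * cube_partial t (p s) x))); last first.
    by move=> x; ring.
  rewrite -Ex_cube_partial; last first.
    by move=> x; rewrite cube_partial_flip.
  rewrite add0r -ExD -ExZ; apply: le_Ex => x.
  set a := cube_partial _ _ _; set b := cube_partial _ _ _.
  have := sqr_ge0 (a - b); lra.
rewrite (@eq_Ex _ _ _ (fun x => \sum_t \sum_s (sgn (x t) * p t x) * (sgn (x s) * p s x))); last first.
  by move=> x; rewrite expr2 big_distrlr.
rewrite Ex_sum.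
apply: (@le_trans _ _ (\sum_t \sum_s ((if s == t then Ex (fun x => p t x ^+ 2) else 0)
    + 2^-1 * (q t s + q s t)))).
  by apply: ler_sum => t _; rewrite Ex_sum; apply: ler_sum => s _; exact: h.
rewrite [leLHS](_ : _ = \sum_t Ex (fun x => p t x ^+ 2) +
   2^-1 * (\sum_t \sum_s q t s + \sum_t \sum_s q s t)); last first.
  rewrite -big_split mulr_sumr -big_split/=; apply: eq_bigr => t _.
  rewrite big_split/= -big_mkcond big_pred1_eq -mulr_sumr big_split//.
have -> : \sum_t \sum_s q s t = \sum_t \sum_s q t s by exact: exchange_big.
by rewrite [leRHS]big_split/= -/(\sum_t \sum_s q t s); lra.
Qed.

Lemma Ex_mul_le F h q : (forall x, `|F x| <= 1) -> 0 <= q ->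
  Ex (fun x => h x ^+ 2) <= q ^+ 2 -> Ex (fun x => F x * h x) <= q.
Proof.
move=> F1 q0 hq.
have F2 : Ex (fun x => F x ^+ 2) <= 1.
  by rewrite -[leRHS](@Ex_cst R T); apply: le_Ex => x; rewrite -real_normK ?num_real// expr_le1.
have [|Fh] := leP (Ex (fun x => F x * h x)) 0; first by move=> /le_trans; apply.
rewrite -ler_sqr ?nnegrE ?(ltW Fh)//; apply: (le_trans (Ex_cauchy_schwarz _ _)).
apply: le_trans hq; rewrite ler_piMl//.
by apply: Ex_ge0 => x; exact: sqr_ge0.
Qed.

(** For any l > 0 one has y <= 5 l + (1 / l) exp (l (y - 5 l)). With y the linear
form this bounds the left side by 5 l times first-order coefficients plus
the pairing of D_t F with the exponentials [p t], which by [Ex_cube_partial] is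
the pairing of [F] with the divergence of [p]. Cauchy-Schwarz and
[Ex_divergence_sqr_le] bound it: the threshold 5 l contributes
exp (- 10 l ^ 2) to the square, the exponential moment exp (8 l ^ 2). *)
Lemma sum_cube_partial_linear_le F (n : T -> R) (u : T -> T -> R) (m l : R) :
  (forall x, `|F x| <= 1) -> (forall t x, 0 <= cube_partial t F x) ->
  (forall t, 0 <= n t) -> (forall t, \sum_s u t s ^+ 2 <= 1) ->
  (forall t, u t t = 0) -> 0 <= m -> \sum_t n t ^+ 2 <= m ^+ 2 -> 1 <= l ->
  \sum_t n t * Ex (fun x => cube_partial t F x * linear_form (u t) x) <=
  5 * l * (\sum_t n t * fourier F [set t]%SET) + 3 * m * expR (- l ^+ 2).
Proof.
move=> F1 F0 n0 u1 utt m0 nm l1.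
pose p t : cube -> R := exp_weight (n t / l * expR (- 5 * l ^+ 2)) l (u t).
have l0 : 0 < l by lra.
have pt t x : p t (flip t x) = p t x by exact: exp_weight_flip.
have pointwise t x : n t * linear_form (u t) x <= 5 * l * n t + p t x.
  rewrite /p /exp_weight -!mulrA -expRD.
  set y := linear_form _ _.
  have := expR_ge1Dx (- 5 * l ^+ 2 + l * y); set e := expR _ => he.
  have : y <= 5 * l + l^-1 * e.
    have -> : y = 5 * l + l^-1 * (- 5 * l ^+ 2 + l * y).
      by field; rewrite gt_eqF.
    by rewrite lerD2l ler_wpM2l ?invr_ge0 ?ltW//; lra.
  by move=> /(ler_wpM2l (n0 t)) => h; apply: le_trans h _; rewrite le_eqVlt; apply/orP; left; apply/eqP; ring.
have step1 : \sum_t n t * Ex (fun x => cube_partial t F x * linear_form (u t) x) <=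
   \sum_t (5 * l * n t * fourier F [set t]%SET + Ex (fun x => cube_partial t F x * p t x)).
  apply: ler_sum => t _.
  rewrite fourier_point -!ExZ -ExD; apply: le_Ex => x.
  have := ler_wpM2l (F0 t x) (pointwise t x); lra.
apply: (le_trans step1); rewrite big_split/= mulr_sumr.
rewrite (eq_bigr (fun t => 5 * l * (n t * fourier F [set t]%SET))); last first.
  by move=> t _; rewrite !mulrA.
rewrite lerD2l.
rewrite (eq_bigr (fun t => Ex (fun x => F x * (sgn (x t) * p t x)))); last first.
  by move=> t _; rewrite Ex_cube_partial.
rewrite -Ex_sum (@eq_Ex _ _ _ (fun x => F x * \sum_t sgn (x t) * p t x)); last first.
  by move=> x; rewrite mulr_sumr.
apply: Ex_mul_le => //; first by rewrite !mulr_ge0 ?expR_ge0.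
apply: (le_trans (Ex_divergence_sqr_le pt)).
apply: (@le_trans _ _ (\sum_t 5 * n t ^+ 2 * expR (- 2 * l ^+ 2))).
  apply: ler_sum => t _.
  pose P := Ex (fun x : cube => p t x ^+ 2).
  have P0 : 0 <= P by apply: Ex_ge0 => x; exact: sqr_ge0.
  have -> : expR (- 2 * l ^+ 2) = expR (- 5 * l ^+ 2) ^+ 2 * expR (8 * l ^+ 2).
    by rewrite -expRM_natl -expRD; congr expR; ring.
  have hP : P <= n t ^+ 2 / l ^+ 2 * (expR (- 5 * l ^+ 2) ^+ 2 * expR (8 * l ^+ 2)).
    apply: (le_trans (Ex_exp_weight_sqr _ _ (u1 t))).
    by rewrite !exprMn exprVn !mulrA.
  have hs : \sum_s Ex (fun x => cube_partial s (p t) x ^+ 2) <= 4 * l ^+ 2 * P.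
    apply: (@le_trans _ _ (\sum_s (4 * l ^+ 2 * P) * u t s ^+ 2)).
      apply: ler_sum => s _; apply: (le_trans (Ex_cube_partial_exp_weight_sqr _ _ _ _)).
      by rewrite -/P; lra.
    by rewrite -mulr_sumr ler_piMr//; have := sqr_ge0 l; nra.
  apply: (@le_trans _ _ (5 * l ^+ 2 * P)).
    have : P <= l ^+ 2 * P by rewrite ler_peMl//; nra.
    rewrite -/P; lra.
  apply: (le_trans (ler_wpM2l _ hP)); first by rewrite mulr_ge0 ?sqr_ge0.
  set e := _ * expR _; rewrite le_eqVlt; apply/orP; left; apply/eqP; field.
  by rewrite gt_eqF.
rewrite -mulr_suml -mulr_sumr.
rewrite !exprMn -expRM_natl.
have -> : 2%:R * - l ^+ 2 = - 2 * l ^+ 2 by ring.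
rewrite ler_wpM2r ?expR_ge0//.
have := sqr_ge0 m; lra.
Qed.

End linear_test.

(** * Averages over sets of a given size *)

Section sets.
Context {R : realType} {T : finType}.
Implicit Types (u c : {set T} -> R) (s t : T) (S U B : {set T}).

Lemma sum_add_point u r :
  \sum_(B : {set T} | #|B| == r) \sum_(s | s \notin B) u (s |: B)%SET =
  r.+1%:R * \sum_(B : {set T} | #|B| == r.+1) u B.
Proof.
have -> : r.+1%:R * \sum_(B : {set T} | #|B| == r.+1) u B =
    \sum_(B : {set T} | #|B| == r.+1) \sum_(s in B) u B.
  rewrite mulr_sumr; apply: eq_bigr => B /eqP Br.
  by rewrite sumr_const Br mulr_natl.
rewrite (exchange_big_dep xpredT)//= [RHS](exchange_big_dep xpredT)//=.
apply: eq_bigr => s _.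
rewrite [RHS](reindex_onto (fun B => s |: B)%SET (fun B => B :\ s)%SET)/=; last first.
  by move=> B /andP[_ sB]; rewrite finset.setD1K.
apply: eq_bigl => B; rewrite setU11 andbT.
have [sB|sB] := boolP (s \in B); rewrite ?andbF ?andbT.
  apply/esym/negbTE; rewrite negb_and; apply/orP; right.
  by apply: contraTneq sB => <-; rewrite !inE eqxx.
by rewrite cardsU1 sB finset.setU1K// eqxx andbT eqSS.
Qed.

Lemma sum_points u : \sum_t u [set t]%SET = \sum_(B : {set T} | #|B| == 1%N) u B.
Proof.
have := sum_add_point u 0; rewrite mul1r => <-.
rewrite (big_pred1 finset.set0) => [|B]; last by rewrite cards_eq0.
by apply: eq_big => [s|s _]; rewrite ?inE ?finset.setU0.
Qed.

Lemma sum_pairs u :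
  \sum_t \sum_(s | s != t) u [set s; t]%SET = 2 * \sum_(B : {set T} | #|B| == 2%N) u B.
Proof.
rewrite -(sum_add_point u 1) -(sum_points (fun B => \sum_(s | s \notin B) u (s |: B)%SET)).
by apply: eq_bigr => t _; apply: eq_bigl => s; rewrite inE.
Qed.

(** The mean of [u] over the uniformly random set of [r] points. *)
Definition slice_avg r u : R :=
  'C(#|T|, r)%:R^-1 * \sum_(B : {set T} | #|B| == r) u B.

Lemma le_slice_avg r u c : (forall B, u B <= c B) -> slice_avg r u <= slice_avg r c.
Proof. by move=> uc; rewrite /slice_avg ler_wpM2l ?invr_ge0// ler_sum. Qed.

Lemma slice_avgZ r a u : slice_avg r (fun B => a * u B) = a * slice_avg r u.
Proof. by rewrite /slice_avg -mulr_sumr mulrCA. Qed.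

Lemma slice_avgD r u c :
  slice_avg r (fun B => u B + c B) = slice_avg r u + slice_avg r c.
Proof. by rewrite /slice_avg big_split mulrDr. Qed.

Lemma slice_avg_cst r a : (r <= #|T|)%N -> slice_avg r (fun=> a) = a.
Proof.
move=> rT; rewrite /slice_avg sumr_const.
have -> : #|[pred B : {set T} | #|B| == r]| = 'C(#|T|, r).
  by rewrite -card_draws; apply: eq_card => B; rewrite !inE.
by rewrite -[X in _ * X]mulr_natr mulrCA mulVf ?mulr1// pnatr_eq0 -lt0n bin_gt0.
Qed.

Lemma slice_avg0 u : slice_avg 0 u = u finset.set0.
Proof.
rewrite /slice_avg bin0 invr1 mul1r (big_pred1 finset.set0)// => B.
by rewrite cards_eq0.
Qed.

Lemma slice_avgT u : slice_avg #|T| u = u [set: T]%SET.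
Proof.
rewrite /slice_avg binn invr1 mul1r (big_pred1 [set: T]%SET)// => B.
by rewrite /= eqEcard finset.subsetT cardsT eqn_leq max_card.
Qed.

(** A uniform set of r.+1 points is a uniform set of r points with a uniform
new point added. *)
Lemma slice_avgS r u : (r < #|T|)%N ->
  (#|T| - r)%:R * (slice_avg r.+1 u - slice_avg r u) =
  slice_avg r (fun B => \sum_(s | s \notin B) (u (s |: B)%SET - u B)).
Proof.
move=> rT; rewrite /slice_avg.
have C1 : ('C(#|T|, r)%:R != 0 :> R) by rewrite pnatr_eq0 -lt0n bin_gt0 ltnW.
have C2 : ('C(#|T|, r.+1)%:R != 0 :> R) by rewrite pnatr_eq0 -lt0n bin_gt0.
have CE : (r.+1%:R * 'C(#|T|, r.+1)%:R = (#|T| - r)%:R * 'C(#|T|, r)%:R :> R).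
  by rewrite -!natrM mul_bin_left.
under [in RHS]eq_bigr do rewrite big_split.
rewrite [in RHS]big_split/= sum_add_point mulrBr.
have -> : \sum_(B : {set T} | #|B| == r) \sum_(s | s \notin B) - u B =
    - ((#|T| - r)%:R * \sum_(B : {set T} | #|B| == r) u B).
  rewrite mulr_sumr -sumrN; apply: eq_bigr => B /eqP Br.
  rewrite sumr_const.
  have -> : #|[pred s | s \notin B]| = (#|T| - r)%N.
    by rewrite -Br -(finset.setCK B) -cardsCs finset.setCK; apply: eq_card => s; rewrite !inE.
  by rewrite mulNrn mulr_natl.
rewrite mulrBr; congr (_ - _); last by rewrite mulrCA.
rewrite !mulrA; congr (_ * _).
have -> : r.+1%:R = (#|T| - r)%:R * 'C(#|T|, r)%:R / 'C(#|T|, r.+1)%:R :> R.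
  by rewrite -CE mulfK.
by field; rewrite C1 C2.
Qed.

(** With [c S] the product of the coefficients of [F] and [G] at [S], layer 0 is
the correlation obtained by sharing the flips in [B]; layers 1 and 2 are the
first- and second-order sums of the functions frozen on [B]. *)
Definition layer c j B : R := \sum_(S | #|S :\: B|%SET == j) c S.

(** Adding a point of [S] to [B] shrinks the part of [S] outside [B] by one, and
there are #|S minus B| such points; all other additions change nothing. *)
Lemma layerS c j B :
  \sum_(s | s \notin B) (layer c j (s |: B)%SET - layer c j B) =
  j.+1%:R * layer c j.+1 B - j%:R * layer c j B.
Proof.
rewrite /layer.
under eq_bigr => s _ do rewrite !(big_mkcond (fun S => _ == j)) -sumrB/=.
rewrite exchange_big/= !(big_mkcond (fun S => _ == _)) !mulr_sumr -sumrB.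
apply: eq_bigr => S _.
have hS s : s \notin B -> (if #|S :\: (s |: B)|%SET == j then c S else 0) -
    (if #|S :\: B|%SET == j then c S else 0) =
    if s \in S then (if #|S :\: B|%SET == j.+1 then c S else 0) -
    (if #|S :\: B|%SET == j then c S else 0) else 0.
  move=> sB; have [sS|sS] := boolP (s \in S).
    have -> : #|S :\: B|%SET = #|S :\: (s |: B)|%SET.+1.
      rewrite (cardsD1 s (S :\: B)%SET) !inE sB sS/= add1n; congr _.+1.
      by apply: eq_card => t; rewrite !inE negb_or andbA.
    by rewrite eqSS.
  rewrite (_ : S :\: (s |: B) = S :\: B)%SET ?subrr//.
  apply/setP => t; rewrite !inE negb_or.
  by have [->|] := eqVneq t s; rewrite ?(negbTE sS) ?andbF.
rewrite (eq_bigr _ hS) -big_mkcondr/= sumr_const.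
have -> : #|[pred s | (s \notin B) && (s \in S)]| = #|S :\: B|%SET.
  by apply: eq_card => s; rewrite !inE.
set q := #|_|; have [->|qj1] := eqVneq q j.+1.
  by rewrite -[j.+1 == j]/(j.+1 == j) (gtn_eqF (ltnSn j)) !subr0 mulr0 subr0 mulr_natl.
have [->|qj] := eqVneq q j; first by rewrite !sub0r mulr0 add0r mulNrn mulr_natl.
by rewrite subrr mul0rn !mulr0 subrr.
Qed.

Lemma layer_points c B :
  \sum_t \sum_(S | (S :\: B)%SET == [set t]%SET) c S = layer c 1 B.
Proof.
rewrite (sum_points (fun U => \sum_(S | (S :\: B)%SET == U) c S)) /layer.
rewrite [RHS](partition_big (fun S => S :\: B)%SET (fun U => #|U| == 1%N))//=.
apply: eq_bigr => U U1; apply: eq_bigl => S.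
by case: eqVneq => [->|]; rewrite ?andbF ?U1.
Qed.

Lemma layer_pairs c B :
  \sum_t \sum_(s | s != t) \sum_(S | (S :\: B)%SET == [set s; t]%SET) c S =
  2 * layer c 2 B.
Proof.
rewrite (sum_pairs (fun U => \sum_(S | (S :\: B)%SET == U) c S)) /layer.
rewrite [in RHS](partition_big (fun S => S :\: B)%SET (fun U => #|U| == 2%N))//=.
congr (_ * _); apply: eq_bigr => U U1; apply: eq_bigl => S.
by case: eqVneq => [->|]; rewrite ?andbF ?U1.
Qed.

End sets.

(** * A recursion with slow decay *)

Section recursion.
Context {R : realType}.

Lemma slices_nondecreasing (m : nat) (k w : nat -> R) :
  (forall r, (r <= m)%N -> 0 <= w r) ->
  (forall r, (r < m)%N -> (m - r)%:R * (k r.+1 - k r) = w r) ->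
  forall r r', (r <= r' <= m)%N -> k r <= k r'.
Proof.
move=> w0 kS r r' /andP[]; elim: r' => [|r' ih]; first by rewrite leqn0 => /eqP ->.
rewrite leq_eqVlt => /predU1P[-> //|]; rewrite ltnS => rr' r'm.
apply: (le_trans (ih rr' (ltnW r'm))).
have mr : 0 < (m - r')%:R :> R by rewrite ltr0n subn_gt0.
by rewrite -subr_ge0 -(pmulr_rge0 _ mr) kS// w0// ltnW.
Qed.

(** By induction w_r >= W (1 - 72 a r / m) as long as 144 a r <= m: in this range
m - r >= m / 2, so each step loses at most (52 a w_r + 20 a W) / m. Hence the
first m / (144 a) increments of [k] are at least W / (2 m) each. *)
Lemma slow_decay_growth (m : nat) (k w : nat -> R) (a W : R) :
  (0 < m)%N -> 1 <= a -> 0 <= W ->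
  (forall r, (r <= m)%N -> 0 <= w r) -> W <= w 0%N ->
  (forall r, (r < m)%N -> (m - r)%:R * (k r.+1 - k r) = w r) ->
  (forall r, (r < m)%N ->
    - (26 * a * w r + 10 * a * W) <= (m - r)%:R * (w r.+1 - w r)) ->
  W / (288 * a) <= k m - k 0%N.
Proof.
move=> m0 a1 W0 w0 Ww kS wS.
have mR : 0 < m%:R :> R by rewrite ltr0n.
have mr r : (r < m)%N -> 0 < (m - r)%:R :> R by move=> rm; rewrite ltr0n subn_gt0.
have kmono := slices_nondecreasing w0 kS.
have small r : 144 * r%:R * a <= m%:R -> (2 * r <= m)%N.
  move=> h; rewrite -(ler_nat R) natrM; have := ler0n R r; nra.
have wlow r : 144 * r%:R * a <= m%:R -> W * (1 - 72 * r%:R * a / m%:R) <= w r.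
  elim: r => [|r ih] hr; first by rewrite mulr0 !mul0r subr0 mulr1.
  have r0 := ler0n R r.
  have hr' : 144 * r%:R * a <= m%:R by move: hr; rewrite -[r.+1%:R]natr1; nra.
  have rm : (r < m)%N by have := small _ hr; lia.
  have := wS _ rm; have := ih hr'.
  have := small _ hr'; rewrite -(ler_nat R) natrM natrB ?(ltnW rm)//.
  move: hr; rewrite -[r.+1%:R]natr1.
  have := w0 _ (ltnW rm); move: (w r) (w r.+1) => x y.
  have -> : W * (1 - 72 * r%:R * a / m%:R) = (W * (m%:R - 72 * r%:R * a)) / m%:R.
    by field; rewrite gt_eqF.
  have -> : W * (1 - 72 * (r%:R + 1) * a / m%:R) = (W * (m%:R - 72 * (r%:R + 1) * a)) / m%:R.
    by field; rewrite gt_eqF.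
  rewrite !ler_pdivrMr//.
  move: (m%:R) mR (r%:R) r0 => M M0 r0' r0 x0 h1 h2 h3 h4.
  have h5 : - (26 * a * x + 10 * a * W) * 2 <= M * (y - x).
    have [xy|xy] := leP x y; first by apply: (@le_trans _ _ 0); nra.
    have : M * (x - y) <= 2 * ((M - r0') * (x - y)) by nra.
    lra.
  pose g := 1 - 72 * r0' * a / M.
  have hg : M * g = M - 72 * r0' * a by rewrite /g; field; rewrite gt_eqF.
  have g1 : 0 <= 1 - g by rewrite /g opprB addrC subrK divr_ge0 ?(ltW M0)// mulr_ge0 ?mulr_ge0//; lra.
  have Wg : 0 <= x - W * g.
    by rewrite subr_ge0 -(ler_pM2l M0) mulrCA hg [leRHS]mulrC.
  have h6 : 0 <= (M - 52 * a) * (x - W * g) by rewrite mulr_ge0//; nra.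
  have h7 : 0 <= a * W * (1 - g) by rewrite mulr_ge0//; nra.
  have h8 : W * (M * g) = W * (M - 72 * r0' * a) by rewrite hg.
  lra.
have klow r : 144 * r%:R * a <= m%:R -> (r.+1)%:R * (W / (2 * m%:R)) <= k r.+1 - k 0%N.
  have step i : 144 * i%:R * a <= m%:R -> W / (2 * m%:R) <= k i.+1 - k i.
    move=> hi; have im : (i < m)%N by have := small _ hi; lia.
    rewrite -(ler_pM2l (mr _ im)) kS//.
    have := wlow _ hi.
    have -> : W * (1 - 72 * i%:R * a / m%:R) = (W * (m%:R - 72 * i%:R * a)) / m%:R.
      by field; rewrite gt_eqF.
    apply: le_trans; rewrite mulrA ler_pdivlMr// natrB ?(ltnW im)//.
    have -> : (m%:R - i%:R) * W / (2 * m%:R) * m%:R = (m%:R - i%:R) * W / 2.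
      by field; rewrite gt_eqF.
    have := ler0n R i; move: (i%:R) (m%:R) hi mR => I M hi M0 I0; nra.
  elim: r => [|r ih] hr; first by rewrite mul1r; exact: step.
  have hr' : 144 * r%:R * a <= m%:R by move: hr; rewrite -[r.+1%:R]natr1; nra.
  have := step _ hr; have := ih hr'.
  rewrite -[r.+2%:R]natr1; lra.
pose X := m%:R / (144 * a).
have X0 : 0 <= X by rewrite divr_ge0//; lra.
(* The indices 0, ..., q are admissible, and there are q + 1 >= X of them. *)
pose q := Num.truncn X.
have /andP[qX Xq] : q%:R <= X < q.+1%:R by rewrite truncn_itv.
have hq : 144 * q%:R * a <= m%:R.
  have a0 : 0 < 144 * a by lra.
  by move: qX; rewrite /X ler_pdivlMr// mulrA [_ * 144]mulrC.
have qm : (q < m)%N by have := small _ hq; lia.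
have := klow _ hq; have := kmono q.+1 m; rewrite qm leqnn => /(_ isT).
have : X * (W / (2 * m%:R)) <= q.+1%:R * (W / (2 * m%:R)).
  by apply: ler_wpM2r (ltW Xq); rewrite divr_ge0// mulr_ge0.
have -> : X * (W / (2 * m%:R)) = W / (288 * a).
  by rewrite /X; field; apply/andP; split; rewrite gt_eqF//; lra.
lra.
Qed.

End recursion.

(** * Correlation of increasing functions on the cube *)

Section cube_correlation.
Context {R : realType} {T : finType}.
Local Notation cube := {ffun T -> bool}.
Implicit Types (F G h : cube -> R) (x y z : cube) (s t : T) (S U B : {set T}).

Definition cube_admissible F :=
  (forall x, `|F x| <= 1) /\ (forall t x, 0 <= cube_partial t F x).

Lemma fourier_point_ge0 F t : cube_admissible F -> 0 <= fourier F [set t]%SET.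
Proof.
by move=> [_ F0]; rewrite fourier_point; exact: Ex_ge0.
Qed.

Lemma bessel F (P : pred {set T}) : cube_admissible F ->
  \sum_(S | P S) fourier F S ^+ 2 <= 1.
Proof.
move=> [F1 _]; apply: (@le_trans _ _ (\sum_S fourier F S * fourier F S)).
  rewrite [leRHS](bigID P)/= (eq_bigr (fun S => fourier F S * fourier F S)) ?lerDl.
    by apply: sumr_ge0 => S _; rewrite -expr2 sqr_ge0.
  by move=> S _; rewrite expr2.
rewrite -parseval -[leRHS](@Ex_cst R T); apply: le_Ex => x.
by rewrite -expr2 -real_normK ?num_real// expr_le1.
Qed.

Lemma cube_partial_merge B z F t x :
  cube_partial t (fun y => F (merge B z y)) x =
  if t \in B then 0 else cube_partial t F (merge B z x).
Proof.
have [tB|tB] := boolP (t \in B).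
  rewrite /cube_partial (_ : merge B z (flip t x) = merge B z x) ?subrr ?mulr0 ?mul0r//.
  by apply/ffunP => s; rewrite !ffunE; case: eqP => [->|]; rewrite ?tB.
rewrite /cube_partial (_ : merge B z (flip t x) = flip t (merge B z x)).
  by rewrite [in sgn (merge _ _ _ _)]ffunE (negbTE tB).
apply/ffunP => s; rewrite !ffunE; case: eqP => [->|_] //.
by rewrite (negbTE tB).
Qed.

Lemma merge_admissible B z F :
  cube_admissible F -> cube_admissible (fun x => F (merge B z x)).
Proof.
by move=> [F1 F0]; split=> [x|t x]; rewrite ?F1// cube_partial_merge; case: ifP.
Qed.

(** The left side is - sum_t E [D_t F * l_t], with l_t the linear form of
coefficients G^({s, t}). Normalising l_t by its norm N_t and applying
[sum_cube_partial_linear_le] to F leaves the sum of the N_t F^({t}). But N_t is itself the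
pairing of D_t G with the normalised form l_t / N_t, so the same lemma applied
to G, with weights F^({t}), replaces N_t by a multiple of G^({t}). *)
Lemma level2_le F G (l : R) : cube_admissible F -> cube_admissible G -> 1 <= l ->
  - (\sum_t \sum_(s | s != t) fourier F [set s; t]%SET * fourier G [set s; t]%SET)
  <= 25 * l ^+ 2 * (\sum_t fourier F [set t]%SET * fourier G [set t]%SET)
     + 20 * l * expR (- l ^+ 2).
Proof.
move=> aF aG l1.
pose b t s := if s == t then 0 else fourier G [set s; t]%SET.
pose N t := Num.sqrt (\sum_s b t s ^+ 2).
have N0 t : 0 <= N t by exact: sqrtr_ge0.
have sb0 t : 0 <= \sum_s b t s ^+ 2 by apply: sumr_ge0 => s _; exact: sqr_ge0.
have N2 t : N t ^+ 2 = \sum_s b t s ^+ 2 by rewrite sqr_sqrtr.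
pose u t s := - (b t s / N t).
have uN t s : N t * u t s = - b t s.
  have [Nt|Nt] := eqVneq (N t) 0; last by rewrite /u mulrN mulrCA divff// mulr1.
  rewrite Nt mul0r; have /eqP := N2 t; rewrite Nt expr0n/= eq_sym.
  rewrite psumr_eq0 => [/allP/(_ s (mem_index_enum _))/=|? _]; last exact: sqr_ge0.
  by rewrite sqrf_eq0 => /eqP ->; rewrite oppr0.
have u1 t : \sum_s u t s ^+ 2 <= 1.
  rewrite (eq_bigr (fun s => (N t ^+ 2)^-1 * b t s ^+ 2)); last first.
    by move=> s _; rewrite /u sqrrN exprMn exprVn mulrC.
  rewrite -mulr_sumr -N2; have [->|Nt] := eqVneq (N t) 0; first by rewrite expr0n/= mulr0.
  by rewrite mulVf// expf_neq0.
have utt t : u t t = 0 by rewrite /u /b eqxx mul0r oppr0.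
have sN : \sum_t N t ^+ 2 <= (3 / 2) ^+ 2.
  rewrite (eq_bigr (fun t => \sum_(s | s != t) fourier G [set s; t]%SET ^+ 2)); last first.
    move=> t _; rewrite N2 [RHS]big_mkcond/=; apply: eq_bigr => s _.
    by rewrite /b; case: eqP; rewrite //= expr0n.
  rewrite (sum_pairs (fun U => fourier G U ^+ 2)).
  by have := bessel (fun U => #|U| == 2%N) aG; lra.
pose a t := fourier F [set t]%SET.
have a0 t : 0 <= a t by exact: fourier_point_ge0.
have sa : \sum_t a t ^+ 2 <= 1 ^+ 2.
  rewrite expr1n (sum_points (fun U => fourier F U ^+ 2)).
  exact: bessel.
have E : - (\sum_t \sum_(s | s != t) fourier F [set s; t]%SET * fourier G [set s; t]%SET) =
    \sum_t N t * Ex (fun x => cube_partial t F x * linear_form (u t) x).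
  rewrite -sumrN; apply: eq_bigr => t _.
  rewrite Ex_cube_partial; last first.
    by move=> x; rewrite linear_form_flip utt mulr0 mul0r subr0.
  rewrite -ExZ (@eq_Ex _ _ _ (fun x => \sum_s - b t s * (F x * (sgn (x t) * sgn (x s))))); last first.
    move=> x; rewrite /linear_form !mulr_sumr; apply: eq_bigr => s _.
    by rewrite -uN; ring.
  rewrite Ex_sum big_mkcond -sumrN/=; apply: eq_bigr => s _.
  rewrite ExZ /b; have [_|st] := eqVneq s t; first by rewrite oppr0 mul0r.
  rewrite mulNr mulrC; congr (- (_ * _)).
  by apply: eq_Ex => x; rewrite walsh2// [sgn (x s) * _]mulrC.
have E2 : \sum_t N t * a t = \sum_t a t * Ex (fun x => cube_partial t G x * linear_form (fun s => - u t s) x).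
  apply: eq_bigr => t _; rewrite mulrC; congr (_ * _).
  rewrite Ex_cube_partial; last first.
    by move=> x; rewrite linear_form_flip utt oppr0 mulr0 mul0r subr0.
  rewrite (@eq_Ex _ _ _ (fun x => \sum_s - u t s * (G x * (sgn (x t) * sgn (x s))))); last first.
    by move=> x; rewrite /linear_form !mulr_sumr; apply: eq_bigr => s _; ring.
  rewrite Ex_sum (eq_bigr (fun s => b t s ^+ 2 / N t)); last first.
    move=> s _; rewrite ExZ /u opprK expr2 mulrAC; congr (_ * _).
    rewrite /b; have [_|st] := eqVneq s t; first by rewrite !mul0r.
    congr (_ * _); apply: eq_Ex => x; rewrite walsh2// [sgn (x s) * _]mulrC//.
  rewrite -mulr_suml -N2; have [->|Nt] := eqVneq (N t) 0; first by rewrite invr0 mulr0.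
  by rewrite expr2 mulfK.
(* 3 * (3 / 2) + 15 * l <= 20 * l absorbs both error terms as l >= 1. *)
rewrite E.
have h1 := sum_cube_partial_linear_le aF.1 aF.2 N0 u1 utt _ sN l1.
have u1' t : \sum_s (- u t s) ^+ 2 <= 1.
  by rewrite (eq_bigr (fun s => u t s ^+ 2)) ?u1// => s _; rewrite sqrrN.
have utt' t : - u t t = 0 by rewrite utt oppr0.
have h2 := sum_cube_partial_linear_le aG.1 aG.2 a0 u1' utt' _ sa l1.
apply: (le_trans (h1 _)) => //; rewrite E2.
have h3 : 0 <= 5 * l by lra.
have := ler_wpM2l h3 (h2 ler01).
have := expR_ge0 (- l ^+ 2); move: (expR _) => e e0.
rewrite /a; move: (\sum_t _ * Ex _) (\sum_t _) => A W h4.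
have : 0 <= (l - 1) * e by rewrite mulr_ge0//; lra.
lra.
Qed.

Definition level1 F G := \sum_t fourier F [set t]%SET * fourier G [set t]%SET.

Lemma level1_le1 F G : cube_admissible F -> cube_admissible G -> level1 F G <= 1.
Proof.
move=> aF aG; apply: (le_trans (ler_norm _)).
rewrite -[leRHS]sqrtr1 -sqrtr_sqr ler_wsqrtr//.
apply: (le_trans (sum_cauchy_schwarz _ _)).
rewrite (sum_points (fun U => fourier F U ^+ 2)) (sum_points (fun U => fourier G U ^+ 2)).
have := bessel (fun B => #|B| == 1%N) aF; have := bessel (fun B => #|B| == 1%N) aG.
have : 0 <= \sum_(S : {set T} | #|S| == 1%N) fourier F S ^+ 2 by apply: sumr_ge0 => S _; exact: sqr_ge0.
have : 0 <= \sum_(S : {set T} | #|S| == 1%N) fourier G S ^+ 2 by apply: sumr_ge0 => S _; exact: sqr_ge0.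
move: (\sum_(S | _) _) (\sum_(S | _) _) => A B; nra.
Qed.

Section correlation.
Variables F G : cube -> R.
Hypotheses (aF : cube_admissible F) (aG : cube_admissible G).
Let c S := fourier F S * fourier G S.

Lemma layer1_ge0 B : 0 <= layer c 1 B.
Proof.
rewrite -layer_points; apply: sumr_ge0 => t _; rewrite -Ex_fourier_merge.
by apply: Ex_ge0 => z; rewrite mulr_ge0// fourier_point_ge0//; exact: merge_admissible.
Qed.

Lemma covariance_slices : Ex (fun x => F x * G x) - Ex F * Ex G =
  slice_avg #|T| (layer c 0) - slice_avg 0 (layer c 0).
Proof.
rewrite slice_avgT slice_avg0; congr (_ - _).
  rewrite parseval /layer; apply: eq_bigl => S.
  by rewrite cards_eq0 finset.setDE finset.setCT finset.setI0 eqxx.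
rewrite /layer (big_pred1 finset.set0) => [|S]; last by rewrite finset.setD0 cards_eq0.
by congr (_ * _); apply: eq_Ex => x; rewrite walsh0 mulr1.
Qed.

Lemma slice_layer0S r : (r < #|T|)%N ->
  (#|T| - r)%:R * (slice_avg r.+1 (layer c 0) - slice_avg r (layer c 0)) =
  slice_avg r (layer c 1).
Proof.
move=> rT; rewrite slice_avgS//; congr (_ * _); apply: eq_bigr => B _.
by rewrite layerS mul1r mul0r subr0.
Qed.

Lemma slice_layer1_ge0 r : (r <= #|T|)%N -> 0 <= slice_avg r (layer c 1).
Proof.
by move=> rT; rewrite -(slice_avg_cst (T := T) (r := r) 0)//; exact: le_slice_avg layer1_ge0.
Qed.

Lemma cube_harris : 0 <= Ex (fun x => F x * G x) - Ex F * Ex G.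
Proof.
rewrite covariance_slices subr_ge0.
by apply: (slices_nondecreasing slice_layer1_ge0 slice_layer0S); rewrite leqnn.
Qed.

(** [level2_le] with l ^ 2 = ln (e / V) has the error
20 l exp (- l ^ 2) = 20 l V / e <= 10 l ^ 2 V. Averaging it over the frozen
values gives the hypothesis of [slow_decay_growth] with a = ln (e / V). *)
Lemma cube_correlation V : 0 < V -> V <= level1 F G ->
  V / (288 * ln (expR 1 / V)) <= Ex (fun x => F x * G x) - Ex F * Ex G.
Proof.
move=> V0 VW.
have V1 : V <= 1 by apply: (le_trans VW); exact: level1_le1.
set L := ln _.
have L1 : 1 <= L.
  rewrite /L -ler_expR lnK ?posrE ?divr_gt0 ?expR_gt0//.
  by rewrite ler_pdivlMr// ler_piMr ?expR_ge0.
have eL : expR (- L) = V / expR 1.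
  by rewrite expRN /L lnK ?posrE ?divr_gt0 ?expR_gt0// invf_div.
pose l := Num.sqrt L.
have l2 : l ^+ 2 = L by rewrite sqr_sqrtr//; lra.
have l1 : 1 <= l by rewrite -sqrtr1 ler_wsqrtr.
have T0 : (0 < #|T|)%N.
  rewrite lt0n; apply: contraTneq V0 => T0; rewrite -leNgt; apply: (le_trans VW).
  rewrite /level1 big1 ?lexx// => t _; exfalso.
  by have := max_card (pred1 t); rewrite T0 card1.
have layer2 B : - (25 * L * layer c 1 B + 10 * L * V) <= 2 * layer c 2 B.
  have h z := level2_le (merge_admissible B z aF) (merge_admissible B z aG) l1.
  have := le_Ex h; rewrite ExN ExD ExZ Ex_cst !Ex_sum.
  under eq_bigr => t _.
    rewrite Ex_sum; under eq_bigr => s _ do rewrite Ex_fourier_merge.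
    over.
  under [X in _ <= _ * X + _]eq_bigr => t _ do rewrite Ex_fourier_merge.
  rewrite (layer_pairs c) (layer_points c) l2 eL.
  have e2 : 2 <= expR 1 :> R by have := expR_ge1Dx (1 : R); lra.
  have : 20 * l * (V / expR 1) <= 10 * L * V.
    have : V / expR 1 <= V / 2 by rewrite ler_wpM2l ?(ltW V0)// lef_pV2 ?posrE ?expR_gt0.
    have : l * V <= L * V by rewrite ler_wpM2r ?(ltW V0)// -l2 expr2 ler_peMl//; lra.
    have lpos : 0 < l by lra.
    move=> h1 h2; apply: (@le_trans _ _ (20 * l * (V / 2))); last by lra.
    by rewrite ler_wpM2l//; lra.
  lra.
rewrite covariance_slices.
apply: (slow_decay_growth (k := slice_avg^~ (layer c 0)) (w := slice_avg^~ (layer c 1))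
  T0 L1 (ltW V0) slice_layer1_ge0 _ slice_layer0S).
- rewrite slice_avg0 -layer_points; apply: (le_trans VW); apply: ler_sum => t _.
  rewrite (big_pred1 [set t]%SET) => [|S]; last by rewrite finset.setD0.
  by [].
- move=> r rT; rewrite slice_avgS//.
  rewrite -(slice_avg_cst (T := T) (r := r) (10 * L * V)); last exact: ltnW.
  rewrite -slice_avgZ -slice_avgD -mulN1r -slice_avgZ.
  apply: le_slice_avg => B; rewrite layerS.
  have := layer2 B; have := layer1_ge0 B.
  have : 0 <= (L - 1) * layer c 1 B by rewrite mulr_ge0 ?layer1_ge0//; lra.
  lra.
Qed.

End correlation.
End cube_correlation.

(** * Central binomial coefficients *)

Section binomial.
Local Open Scope classical_set_scope.
Local Open Scope ring_scope.
Context {R : realType}.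

Definition central_ratio (K j : nat) : R := 'C(K.*2, j)%:R / 'C(K.*2, K)%:R.

Lemma central_bin_gt0 K : 0 < 'C(K.*2, K)%:R :> R.
Proof. by rewrite ltr0n bin_gt0 -addnn leq_addr. Qed.

Lemma central_ratio_ge0 K j : 0 <= central_ratio K j.
Proof. by rewrite divr_ge0. Qed.

Lemma central_ratioS K d : (d < K)%N ->
  central_ratio K (K + d.+1) =
  central_ratio K (K + d) * ((K%:R - d%:R) / (K%:R + d%:R + 1)).
Proof.
move=> dK; rewrite /central_ratio addnS.
have := mul_bin_left K.*2 (K + d).
rewrite -addnn subnDl => /(congr1 (fun n => n%:R : R)).
rewrite !natrM natrB ?(ltnW dK)// -[in X in X -> _](natr1 (K + d)) natrD => h.
have nz : K%:R + d%:R + 1 != 0 :> R by rewrite -natrD natr1 pnatr_eq0.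
have -> : 'C(K + K, (K + d).+1)%:R = (K%:R - d%:R) * 'C(K + K, K + d)%:R / (K%:R + d%:R + 1) :> R.
  by rewrite -h mulrAC divff// mul1r.
ring.
Qed.

(** The ratio at offset d is the product over i < d of (K - i) / (K + i + 1),
each factor being 1 - (2 i + 1) / (K + i + 1), and the odd numbers 2 i + 1 add
up to d ^ 2. The lower bound is the same with the inverse factors
1 + (2 i + 1) / (K - i). The bound D on d fixes one denominator for all the
factors. *)
Lemma central_ratio_right_le K D d : (d <= D)%N -> (D <= K)%N ->
  central_ratio K (K + d) <= expR (- (d%:R ^+ 2 / (K%:R + D%:R))).
Proof.
move=> dD DK; elim: d dD => [_|d ih dD].
  by rewrite addn0 expr0n mul0r oppr0 expR0 /central_ratio divff// gt_eqF// central_bin_gt0.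
rewrite central_ratioS ?(leq_trans dD)//.
have -> : - (d.+1%:R ^+ 2 / (K%:R + D%:R)) =
    - (d%:R ^+ 2 / (K%:R + D%:R)) + - ((2 * d%:R + 1) / (K%:R + D%:R)) :> R.
  by rewrite -[d.+1%:R]natr1; ring.
have d0 := ler0n R d; have K0 := ler0n R K.
have dDR : d%:R + 1 <= D%:R :> R by rewrite natr1 ler_nat.
have DKR : D%:R <= K%:R :> R by rewrite ler_nat.
rewrite expRD; apply: ler_pM; [exact: central_ratio_ge0| |exact/ih/ltnW|].
  by rewrite divr_ge0//; lra.
have -> : (K%:R - d%:R) / (K%:R + d%:R + 1) = 1 + - ((2 * d%:R + 1) / (K%:R + d%:R + 1)) :> R.
  by field; rewrite gt_eqF//; lra.
apply: (le_trans (expR_ge1Dx _)); rewrite ler_expR lerN2 ler_wpM2l//.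
by rewrite lef_pV2 ?posrE; lra.
Qed.

Lemma central_ratio_right_ge K D d : (d <= D)%N -> (D < K)%N ->
  expR (- (d%:R ^+ 2 / (K%:R - D%:R))) <= central_ratio K (K + d).
Proof.
move=> dD DK; elim: d dD => [_|d ih dD].
  by rewrite addn0 expr0n mul0r oppr0 expR0 /central_ratio divff// gt_eqF// central_bin_gt0.
rewrite central_ratioS ?(leq_trans dD) ?(ltnW DK)//.
have -> : - (d.+1%:R ^+ 2 / (K%:R - D%:R)) =
    - (d%:R ^+ 2 / (K%:R - D%:R)) + - ((2 * d%:R + 1) / (K%:R - D%:R)) :> R.
  by rewrite -[d.+1%:R]natr1; ring.
have d0 := ler0n R d; have K0 := ler0n R K.
have dDR : d%:R + 1 <= D%:R :> R by rewrite natr1 ler_nat.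
have DKR : D%:R + 1 <= K%:R :> R by rewrite natr1 ler_nat.
rewrite expRD; apply: ler_pM; [exact: expR_ge0|exact: expR_ge0|exact/ih/ltnW|].
rewrite expRN -[leRHS]invrK lef_pV2 ?posrE ?expR_gt0 ?invr_gt0 ?divr_gt0//; [|lra].
rewrite invf_div.
have -> : (K%:R + d%:R + 1) / (K%:R - d%:R) = 1 + (2 * d%:R + 1) / (K%:R - d%:R) :> R.
  by field; rewrite gt_eqF//; lra.
apply: (le_trans (expR_ge1Dx _)); rewrite ler_expR ler_wpM2l//.
by rewrite lef_pV2 ?posrE; lra.
Qed.

Lemma central_ratio_sym K j : (j <= K.*2)%N ->
  central_ratio K j = central_ratio K (K + `|j%:Z - K%:Z|%N).
Proof.
move=> jK; rewrite /central_ratio; have [jK'|jK'] := leqP j K.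
  rewrite (_ : K + _ = K.*2 - j)%N ?bin_sub//; lia.
by rewrite (_ : K + _ = j)%N//; lia.
Qed.

Lemma offset_norm (j K : nat) : (`|j%:Z - K%:Z|%N)%:R = `|j%:R - K%:R| :> R.
Proof.
by rewrite natr_absz intr_norm intrB.
Qed.

Lemma central_ratio_le K j : (j <= K.*2)%N ->
  central_ratio K j <= expR (- ((j%:R - K%:R) ^+ 2 / (K%:R + `|j%:R - K%:R|))).
Proof.
move=> jK; rewrite central_ratio_sym//.
have := @central_ratio_right_le K `|j%:Z - K%:Z|%N _ (leqnn _).
by rewrite offset_norm real_normK ?num_real//; apply; lia.
Qed.

Lemma central_ratio_ge K j : `|j%:R - K%:R| < K%:R :> R ->
  expR (- ((j%:R - K%:R) ^+ 2 / (K%:R - `|j%:R - K%:R|))) <= central_ratio K j.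
Proof.
rewrite -offset_norm ltr_nat => jK; rewrite central_ratio_sym//; last by lia.
have := @central_ratio_right_ge K `|j%:Z - K%:Z|%N _ (leqnn _) jK.
by rewrite offset_norm real_normK ?num_real.
Qed.

End binomial.

(** * Binomial and Gaussian masses of small cells *)

Section cells.
Local Open Scope classical_set_scope.
Local Open Scope ring_scope.
Context {R : realType}.
Local Notation gauss := (normal_prob (0 : R) 1).
Local Notation lebesgue := (@lebesgue_measure R).
Implicit Types (M k j : nat) (x y : R).

(** With 4 M ^ 2 flips the standard deviation of the number of heads is [M], so
the normalised sum takes values with spacing exactly 1 / M. *)
Definition mid_level M : nat := (2 * M ^ 2)%N.
Definition offset M j : R := j%:R - (mid_level M)%:R.
Definition cell M j : set R :=
  [set` `[offset M j / M%:R, (offset M j + 1) / M%:R[ ].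
(** Below the grid the argument of [truncn] is negative and the index is 0,
although the cell 0 does not contain [x]; hence the sign condition in
[cellE]. *)
Definition cell_index M x : nat := Num.truncn (M%:R * x + (mid_level M)%:R).

Lemma mid_levelE M : (mid_level M)%:R = 2 * M%:R ^+ 2 :> R.
Proof. by rewrite /mid_level natrM natrX. Qed.

Lemma cellE M j x : (0 < M)%N ->
  cell M j x <-> (0 <= M%:R * x + (mid_level M)%:R) && (cell_index M x == j).
Proof.
move=> M0; have M0' : 0 < M%:R :> R by rewrite ltr0n.
rewrite /cell /= in_itv/= ler_pdivrMr// ltr_pdivlMr// /offset /cell_index.
set h := (mid_level M)%:R; split=> [/andP[jx xj]|/andP[x0 /eqP <-]].
  have x0 : 0 <= M%:R * x + h by have := ler0n R j; lra.
  rewrite x0/= truncn_eq//; apply/andP; split; first by lra.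
  by rewrite -natr1; lra.
have := truncn_itv x0; rewrite -natr1 => /andP[]; set t := (Num.truncn _)%:R => *.
by apply/andP; split; lra.
Qed.

Lemma cell_offset M j x : (0 < M)%N -> cell M j x ->
  `|x - offset M j / M%:R| <= M%:R^-1.
Proof.
move=> M0; rewrite /cell /= in_itv/= [X in _ < X]mulrDl mul1r => /andP[h1 h2].
by rewrite ler_norml; apply/andP; split; have := invr_ge0 (M%:R : R); lra.
Qed.

Lemma measurable_cell M j : measurable (cell M j).
Proof. exact: measurable_itv. Qed.

Lemma lebesgue_cell M j : (0 < M)%N -> lebesgue (cell M j) = (M%:R^-1)%:E.
Proof.
move=> M0; rewrite /cell lebesgue_measure_itv/= lte_fin ltr_pM2r ?invr_gt0 ?ltr0n//.
by rewrite ltrDl ltr01 -EFinB; congr (_%:E); rewrite [X in X - _]mulrDl mul1r addrC addKr.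
Qed.

Definition cell_mass M j : R := fine (gauss (cell M j)).

Lemma cell_massE M j : (cell_mass M j)%:E = gauss (cell M j).
Proof. by rewrite /cell_mass fineK// fin_num_measure//; exact: measurable_cell. Qed.

Lemma cell_mass_bounds M j (a b : R) : (0 < M)%N ->
  (forall x, cell M j x -> a <= normal_pdf 0 1 x <= b) ->
  a / M%:R <= cell_mass M j <= b / M%:R.
Proof.
move=> M0 ab; rewrite -!lee_fin cell_massE !EFinM -(lebesgue_cell j M0) /normal_prob.
have mc := @measurable_cell M j.
have ip : lebesgue.-integrable (cell M j) (fun x : R => (normal_pdf 0 1 x)%:E).
  by apply: (integrableS measurableT) => //; exact: integrable_normal_pdf.
have ic (c : R) : lebesgue.-integrable (cell M j) (cst c%:E).
  apply/integrableP; split; first exact: measurable_cst.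
  by rewrite integral_cst//= [X in (_ * X)%E](lebesgue_cell j M0) -EFinM ltry.
apply/andP; split; rewrite -integral_cst//; apply: le_integral => // x /set_mem xc;
  by rewrite lee_fin; case/andP: (ab _ xc).
Qed.

Lemma normal_pdf1E x : normal_pdf 0 1 x = normal_peak 1 * expR (- (x ^+ 2 / 2)).
Proof.
rewrite normal_pdfE ?oner_neq0// /normal_fun subr0 expr1n.
by rewrite mulNr.
Qed.

Lemma cell_mass_gt0 M j : (0 < M)%N -> 0 < cell_mass M j.
Proof.
move=> M0.
set B := `|offset M j / M%:R| + 1.
have h : forall x, cell M j x ->
    normal_peak 1 * expR (- (B ^+ 2 / 2)) <= normal_pdf 0 1 x <= normal_peak 1.
  move=> x /(cell_offset M0) xc; rewrite normal_pdf_ub ?oner_neq0// andbT.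
  rewrite normal_pdf1E ler_wpM2l ?normal_peak_ge0// ler_expR lerN2 ler_wpM2r//.
  rewrite -[x ^+ 2]real_normK ?num_real// ler_sqr ?nnegrE ?addr_ge0//.
  have -> : x = (x - offset M j / M%:R) + offset M j / M%:R by rewrite subrK.
  apply: (le_trans (ler_normD _ _)); rewrite /B addrC lerD2l.
  by apply: (le_trans xc); rewrite invf_le1 ?ltr0n// ler1n.
have /andP[+ _] := cell_mass_bounds M0 h; apply: lt_le_trans.
by rewrite divr_gt0 ?ltr0n// mulr_gt0 ?expR_gt0// normal_peak_gt0 ?oner_neq0.
Qed.

Lemma near_cell x : \forall k \near \oo,
  cell k.+1 (cell_index k.+1 x) x /\ (cell_index k.+1 x <= (mid_level k.+1).*2)%N.
Proof.
near=> k.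
have kx : `|x| <= k.+1%:R.
  rewrite ltW//; apply: lt_trans (truncnS_gt `|x|) _.
  by rewrite ltr_nat ltnS; near: k; exists (Num.truncn `|x|).+1.
have k1 : 1 <= k.+1%:R :> R by rewrite ler1n.
have [h1 h2] : - k.+1%:R <= x /\ x <= k.+1%:R.
  by move: kx; rewrite ler_norml => /andP[].
have x0 : 0 <= k.+1%:R * x + (mid_level k.+1)%:R by rewrite mid_levelE; nra.
split; first by apply/cellE => //; rewrite x0 eqxx.
rewrite /cell_index -(ler_nat R); apply: (@le_trans _ _ (k.+1%:R * x + (mid_level k.+1)%:R)).
  by have /andP[] := truncn_itv x0.
by rewrite -addnn natrD mid_levelE; nra.
Unshelve. all: by end_near. Qed.

Lemma cvg_invS : (k.+1%:R^-1 : R) @[k --> \oo] --> (0 : R).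
Proof. exact: cvg_harmonic. Qed.

Lemma cvg_position x :
  offset k.+1 (cell_index k.+1 x) / k.+1%:R @[k --> \oo] --> x.
Proof.
apply/cvgrPdist_le => e e0; near=> k.
have [xc _] : cell k.+1 (cell_index k.+1 x) x /\ (cell_index k.+1 x <= (mid_level k.+1).*2)%N.
  by near: k; exact: near_cell.
apply: (le_trans (cell_offset (ltn0Sn k) xc)).
near: k; have /cvgrPdist_le/(_ _ e0) := cvg_invS.
apply: filterS => k; rewrite sub0r normrN; apply: le_trans; exact: ler_norm.
Unshelve. all: by end_near. Qed.

(** At offset d with d / M tending to x and K = 2 M ^ 2, both
d ^ 2 / (K + |d|) and d ^ 2 / (K - |d|) tend to x ^ 2 / 2. *)
Lemma cvg_central_ratio x :
  central_ratio (mid_level k.+1) (cell_index k.+1 x) @[k --> \oo] --> expR (- (x ^+ 2 / 2)).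
Proof.
pose u k : R := offset k.+1 (cell_index k.+1 x) / k.+1%:R.
have cu : u k @[k --> \oo] --> x by exact: cvg_position.
have cv (s : R) : expR (- (u k ^+ 2 / (2 + s * (`|u k| * k.+1%:R^-1)))) @[k --> \oo]
    --> expR (- (x ^+ 2 / 2)).
  apply: (cvg_comp _ expR); last exact: continuous_expR.
  apply: cvgN; apply: cvgM.
    by rewrite expr2; under eq_fun do rewrite expr2; exact: cvgM.
  apply: cvgV; first by rewrite pnatr_eq0.
  rewrite -[X in _ --> X]addr0; apply: cvgD; first exact: cvg_cst.
  rewrite -[X in _ --> X](mulr0 s); apply: cvgM; first exact: cvg_cst.
  rewrite -[X in _ --> X](mulr0 `|x|); apply: cvgM; last exact: cvg_invS.
  exact: cvg_norm.
apply: (squeeze_cvgr _ (cv (-1)) (cv 1)).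
near=> k.
have [xc jK] : cell k.+1 (cell_index k.+1 x) x /\ (cell_index k.+1 x <= (mid_level k.+1).*2)%N.
  by near: k; exact: near_cell.
have k0 : 0 < k.+1%:R :> R by rewrite ltr0n.
have ub : `|u k| <= `|x| + 1.
  near: k; have /cvgrPdist_le/(_ 1 ltr01) := cu; apply: filterS => k h.
  have -> : u k = x - (x - u k) by rewrite opprB addrC subrK.
  by apply: (le_trans (ler_normB _ _)); rewrite lerD2l.
have kx : `|x| + 1 < k.+1%:R.
  apply: lt_trans (truncnS_gt (`|x| + 1)) _.
  by rewrite ltr_nat ltnS; near: k; exists (Num.truncn (`|x| + 1)).+1.
have E (s : R) : u k ^+ 2 / (2 + s * (`|u k| * k.+1%:R^-1)) =
   offset k.+1 (cell_index k.+1 x) ^+ 2 / ((mid_level k.+1)%:R + s * `|offset k.+1 (cell_index k.+1 x)|).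
  have ou : offset k.+1 (cell_index k.+1 x) = u k * k.+1%:R by rewrite divfK// gt_eqF.
  rewrite ou [`|u k * _|]normrM (ger0_norm (ltW k0)) mid_levelE.
  have -> : 2 * k.+1%:R ^+ 2 + s * (`|u k| * k.+1%:R) =
     (2 + s * (`|u k| * k.+1%:R^-1)) * k.+1%:R ^+ 2 :> R by field; rewrite addrC natr1.
  by rewrite [(u k * _) ^+ 2]exprMn -mulf_div divff ?mulr1// expf_neq0// gt_eqF.
rewrite !E mul1r mulN1r; apply/andP; split; last exact: central_ratio_le.
apply: central_ratio_ge.
have -> : (cell_index k.+1 x)%:R - (mid_level k.+1)%:R = u k * k.+1%:R.
  by rewrite -[LHS]/(offset k.+1 (cell_index k.+1 x)) divfK// gt_eqF.
by rewrite [`|u k * _|]normrM (ger0_norm (ltW k0)) mid_levelE; nra.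
Unshelve. all: by end_near. Qed.

Lemma cvg_cell_mass x :
  k.+1%:R * cell_mass k.+1 (cell_index k.+1 x) @[k --> \oo] --> normal_pdf 0 1 x.
Proof.
apply/cvgrPdist_le => e e0.
have := @continuous_normal_pdf R 0 1 (oner_neq0 _) x.
move=> /cvgrPdist_le/(_ _ e0)/nbhs_ballP[d /= d0 dP].
near=> k.
have [xc jK] : cell k.+1 (cell_index k.+1 x) x /\ (cell_index k.+1 x <= (mid_level k.+1).*2)%N.
  by near: k; exact: near_cell.
have k0 : 0 < k.+1%:R :> R by rewrite ltr0n.
have h y : cell k.+1 (cell_index k.+1 x) y ->
    normal_pdf 0 1 x - e <= normal_pdf 0 1 y <= normal_pdf 0 1 x + e.
  move=> yc; have : `|normal_pdf 0 1 x - normal_pdf 0 1 y| <= e.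
    apply: dP; rewrite /ball/=.
    have h1 := cell_offset (ltn0Sn k) xc; have h2 := cell_offset (ltn0Sn k) yc.
    have h3 : k.+1%:R^-1 <= d / 4.
      near: k; have d4 : 0 < d / 4 by rewrite divr_gt0.
      have /cvgrPdist_le/(_ _ d4) := cvg_invS.
      apply: filterS => k; rewrite sub0r normrN; apply: le_trans; exact: ler_norm.
    set o := offset _ _ / _ in h1 h2.
    have hd : `|x - o| + `|y - o| < d.
      have d_gt0 : (0 : R) < d := d0.
      by apply: (le_lt_trans (lerD (le_trans h1 h3) (le_trans h2 h3))); lra.
    apply: le_lt_trans hd; rewrite [X in `|X|](_ : _ = (x - o) - (y - o)); last by ring.
    exact: ler_normB.
  by rewrite ler_norml => /andP[? ?]; apply/andP; split; lra.
have /andP[] := cell_mass_bounds (ltn0Sn k) h.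
rewrite ler_pdivrMr// ler_pdivlMr// => h1 h2.
by rewrite ler_norml; apply/andP; split; lra.
Unshelve. all: by end_near. Qed.

End cells.

(** * The local de Moivre-Laplace theorem *)

Section normalisation.
Local Open Scope classical_set_scope.
Local Open Scope ring_scope.
Context {R : realType}.
Local Notation gauss := (normal_prob (0 : R) 1).
Local Notation lebesgue := (@lebesgue_measure R).
Implicit Types (M k j : nat) (x y : R).

Lemma indic_cell M i j x : (0 < M)%N -> cell M j x ->
  \1_(cell M i) x = (i == j)%:R :> R.
Proof.
move=> M0 /(cellE _ _ M0)/andP[x0 /eqP xj]; rewrite indicE; congr (_%:R).
have [->|ij] := eqVneq i j; first by rewrite mem_set//; apply/cellE => //; rewrite x0 xj eqxx.
congr nat_of_bool; apply/negbTE/negP => /set_mem/(cellE _ _ M0)/andP[_ /eqP ji].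
by rewrite -ji -xj eqxx in ij.
Qed.

Lemma sum_indic_cell M (c : nat -> R) N j x : (0 < M)%N -> cell M j x -> (j < N)%N ->
  \sum_(i < N) c i * \1_(cell M i) x = c j.
Proof.
move=> M0 xj jN; rewrite (bigD1 (Ordinal jN))//= big1 => [|i ij].
  by rewrite (indic_cell _ M0 xj) eqxx mulr1 addr0.
rewrite (indic_cell _ M0 xj); have /negbTE -> : (i : nat) != j by [].
by rewrite mulr0.
Qed.

Lemma sum_central_ratio K :
  \sum_(i < K.*2.+1) central_ratio K i = 2 ^+ K.*2 / 'C(K.*2, K)%:R :> R.
Proof.
rewrite /central_ratio -mulr_suml; congr (_ / _).
rewrite (_ : 2 = 1 + 1 :> R)// exprDn; apply: eq_bigr => i _.
by rewrite !expr1n mulr1.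
Qed.

Definition central_density M : R :=
  M%:R * 'C((mid_level M).*2, mid_level M)%:R / 2 ^+ (mid_level M).*2.

Let f k x : R :=
  \sum_(i < (mid_level k.+1).*2.+1) central_ratio (mid_level k.+1) i * \1_(cell k.+1 i) x.

Let measurable_f k : measurable_fun [set: R] (f k).
Proof.
apply: measurable_sum => i; apply: measurable_funM => //.
by apply: measurable_indic; exact: measurable_cell.
Qed.

Let integral_f k : (\int[lebesgue]_x (f k x)%:E = ((central_density k.+1)^-1)%:E)%E.
Proof.
under eq_integral => x _ do rewrite /f -sumEFin.
rewrite ge0_integral_sum//=; last 2 first.
- move=> i; apply/measurable_EFinP; apply: measurable_funM => //.
  by apply: measurable_indic; exact: measurable_cell.
- by move=> i x _; rewrite lee_fin mulr_ge0 ?central_ratio_ge0.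
rewrite (eq_bigr (fun i : 'I_(mid_level k.+1).*2.+1 => (central_ratio (mid_level k.+1) i / k.+1%:R)%:E)); last first.
  move=> i _; under eq_integral do rewrite EFinM.
  rewrite ge0_integralZl//=; last 2 first.
  - by apply/measurable_EFinP; apply: measurable_indic; exact: measurable_cell.
  - by rewrite lee_fin central_ratio_ge0.
  rewrite integral_indic//=; last exact: measurable_cell.
  by rewrite setIT [X in (_ * X)%E](lebesgue_cell _ (ltn0Sn k)) EFinM.
rewrite sumEFin -mulr_suml sum_central_ratio; congr (_%:E).
by rewrite /central_density; field; rewrite ?gt_eqF ?central_bin_gt0 ?exprn_gt0//.
Qed.

Let f_ge0 k x : 0 <= f k x.
Proof. by apply: sumr_ge0 => i _; rewrite mulr_ge0 ?central_ratio_ge0. Qed.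

(* On a cell at offset d, d ^ 2 / (K + |d|) >= d ^ 2 / (4 M ^ 2), and x differs
from d / M by at most 1, so x ^ 2 / 2 - 1 <= (d / M) ^ 2. *)
Let f_le k x : f k x <= expR (4^-1) / normal_peak 2 * normal_pdf 0 2 x.
Proof.
have k0 : 0 < k.+1%:R :> R by rewrite ltr0n.
have k1 : 1 <= k.+1%:R :> R by rewrite ler1n.
have rhs : expR (4^-1) / normal_peak 2 * normal_pdf 0 2 x = expR (4^-1 - x ^+ 2 / 8).
  rewrite normal_pdfE ?pnatr_eq0// /normal_fun subr0 mulrA divfK.
    by rewrite -expRD; congr expR; congr (_ + _); field.
  by rewrite gt_eqF// normal_peak_gt0// pnatr_eq0.
rewrite rhs.
have [[j jK xj]|noj] := pselect (exists2 j, (j < (mid_level k.+1).*2.+1)%N & cell k.+1 j x).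
  rewrite /f (sum_indic_cell _ (ltn0Sn k) xj jK).
  apply: (le_trans (central_ratio_le _)) => //; rewrite ler_expR.
  have xo := cell_offset (ltn0Sn k) xj.
  set o := offset k.+1 j in xo; rewrite -/(offset k.+1 j) -/o mid_levelE.
  have oK : `|o| <= 2 * k.+1%:R ^+ 2.
    rewrite /o /offset -mid_levelE ler_norml.
    have : (j%:R <= (mid_level k.+1)%:R + (mid_level k.+1)%:R :> R).
      by rewrite -natrD addnn ler_nat.
    by have := ler0n R j; move=> *; apply/andP; split; lra.
  set y := o / k.+1%:R in xo.
  have xy1 : `|x - y| <= 1 by apply: (le_trans xo); rewrite invf_le1.
  have -> : o = y * k.+1%:R by rewrite /y divfK// gt_eqF.
  have h1 : y ^+ 2 / 4 <= (y * k.+1%:R) ^+ 2 / (2 * k.+1%:R ^+ 2 + `|y * k.+1%:R|).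
    have D0 : 0 < 2 * k.+1%:R ^+ 2 + `|y * k.+1%:R|.
      by rewrite ltr_wpDr// mulr_gt0// exprn_gt0.
    rewrite ler_pdivlMr//.
    have : `|y * k.+1%:R| <= 2 * k.+1%:R ^+ 2 by rewrite /y divfK// gt_eqF.
    have := sqr_ge0 y; move: (`|y * _|) => z; move: (k.+1%:R) => m; nra.
  have h2 : (x - y) ^+ 2 <= 1 by rewrite -real_normK ?num_real// expr_le1.
  have := sqr_ge0 (x - 2 * y); lra.
rewrite /f big1 ?expR_ge0// => i _; rewrite indicE memNset ?mulr0//.
by move=> xi; apply: noj; exists i.
Qed.

Let cvg_f x : f k x @[k --> \oo] --> expR (- (x ^+ 2 / 2)).
Proof.
apply: (cvg_trans _ (@cvg_central_ratio R x)).
apply: near_eq_cvg.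
near=> k.
have [xc jK] : cell k.+1 (cell_index k.+1 x) x /\ (cell_index k.+1 x <= (mid_level k.+1).*2)%N.
  by near: k; exact: near_cell.
by rewrite /f (sum_indic_cell _ (ltn0Sn k) xc).
Unshelve. all: by end_near. Qed.

(** The constant in the local limit theorem, obtained without Stirling's formula:
the central ratios, spread over the cells, have integral 1 / central_density
because the binomial coefficients add up to a power of 2, and by dominated
convergence this integral tends to that of exp (- x ^ 2 / 2). *)
Lemma cvg_central_density : central_density k.+1 @[k --> \oo] --> normal_peak (1 : R).
Proof.
have p0 : normal_peak (1 : R) != 0 by rewrite gt_eqF// normal_peak_gt0 ?oner_neq0.
suff h : (central_density k.+1)^-1 @[k --> \oo] --> (normal_peak (1 : R))^-1.
  rewrite -[X in _ --> X]invrK; under eq_fun do rewrite -[central_density _]invrK.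
  by apply: cvgV => //; rewrite invr_eq0.
have limE : (\int[lebesgue]_x (expR (- (x ^+ 2 / 2)))%:E = ((normal_peak (1 : R))^-1)%:E)%E.
  under eq_integral => x _ do rewrite -[expR _](mulKf p0) -normal_pdf1E EFinM.
  rewrite ge0_integralZl//=; last 3 first.
  - by apply/measurable_EFinP; exact: measurable_normal_pdf.
  - by move=> x _; rewrite lee_fin normal_pdf_ge0.
  - by rewrite lee_fin invr_ge0 normal_peak_ge0.
  by rewrite integral_normal_pdf mule1.
have : (\int[lebesgue]_x (f k x)%:E @[k --> \oo] -->
    \int[lebesgue]_x (expR (- (x ^+ 2 / 2)))%:E)%E.
  apply: (@dominated_cvg _ _ _ lebesgue setT measurableT (fun k x => (f k x)%:E)
    (fun x => (expR (- (x ^+ 2 / 2)))%:E)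
    (fun x => (expR (4^-1) / normal_peak 2)%:E * (normal_pdf 0 2 x)%:E)%E).
  - by move=> k; apply/measurable_EFinP; exact: measurable_f.
  - by move=> x _; apply/fine_cvgP; split; [exact: nearW|exact: cvg_f].
  - by [].
  - by apply: integrableZl => //; exact: integrable_normal_pdf.
  - by move=> k x _; rewrite -EFinM gee0_abs ?lee_fin.
rewrite limE; under eq_fun do rewrite integral_f.
exact: fine_cvg.
Qed.

Definition binomial_weight M j : R := 'C((mid_level M).*2, j)%:R / 2 ^+ (mid_level M).*2.
(** Dividing by the Gaussian mass of the whole cell, and not by the density at a
point, makes integrals of step functions exact ([integral_grid_step]). *)
Definition density_ratio M j : R := binomial_weight M j / cell_mass M j.

Lemma binomial_weight_ge0 M j : 0 <= binomial_weight M j.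
Proof. by rewrite divr_ge0// exprn_ge0. Qed.

Lemma density_ratio_ge0 M j : 0 <= density_ratio M j.
Proof.
by rewrite divr_ge0 ?binomial_weight_ge0// /cell_mass fine_ge0.
Qed.

Lemma cvg_density_ratio x :
  density_ratio k.+1 (cell_index k.+1 x) @[k --> \oo] --> (1 : R).
Proof.
have px : normal_peak 1 * expR (- (x ^+ 2 / 2)) != 0 :> R.
  by rewrite gt_eqF// mulr_gt0 ?expR_gt0// normal_peak_gt0 ?oner_neq0.
have hm : k.+1%:R * cell_mass k.+1 (cell_index k.+1 x) @[k --> \oo] -->
    normal_peak 1 * expR (- (x ^+ 2 / 2)).
  by rewrite -normal_pdf1E; exact: cvg_cell_mass.
have h : central_density k.+1 * central_ratio (mid_level k.+1) (cell_index k.+1 x) *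
    (k.+1%:R * cell_mass k.+1 (cell_index k.+1 x))^-1 @[k --> \oo] --> (1 : R).
  rewrite -[X in _ --> X](divff px); apply: cvgM; last exact: cvgV.
  by apply: cvgM; [exact: cvg_central_density|exact: cvg_central_ratio].
apply: (cvg_trans _ h).
apply: near_eq_cvg; near=> k.
rewrite /density_ratio /binomial_weight /central_density /central_ratio.
have := cell_mass_gt0 (R := R) (cell_index k.+1 x) (ltn0Sn k); set cm := cell_mass _ _ => cm0.
have := central_bin_gt0 (R := R) (mid_level k.+1).
set c := 'C(_, mid_level _)%:R => c0.
field; rewrite (gt_eqF c0) (gt_eqF cm0) ?expf_neq0// addrC natr1 pnatr_eq0.
by rewrite ?andbT.
Unshelve. all: by end_near. Qed.

End normalisation.

(** * Step functions on Gaussian space *)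

Section grid.
Local Open Scope classical_set_scope.
Local Open Scope ring_scope.
Context {R : realType} {n : nat}.
Local Notation gauss := (normal_prob (0 : R) 1).
Local Notation gaussn := (power_probability gauss n).
Implicit Types (M k : nat) (t : n.-tuple R).

Definition levels M := {ffun 'I_n -> 'I_(mid_level M).*2.+1}.
Definition level_of k t : levels k.+1 :=
  [ffun i => inord (cell_index k.+1 (tnth t i))].

Definition box M (m : levels M) : set (n.-tuple R) :=
  [set t | forall i, cell M (m i) (tnth t i)].

(** The expectation of [A] under independent binomial numbers of heads. *)
Definition grid_mean M (A : levels M -> R) : R :=
  \sum_(m : levels M) (\prod_i binomial_weight M (m i)) * A m.

Definition grid_step M (A : levels M -> R) t : R :=
  \sum_(m : levels M) A m * (\prod_i density_ratio M (m i)) * \1_(box m) t.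

Lemma measurable_box M (m : levels M) : measurable (box m).
Proof.
rewrite (_ : box m = \bigcap_(i in [set: 'I_n]) ((@tnth n R) ^~ i @^-1` cell M (m i))).
  apply: fin_bigcap_measurable => // i _.
  rewrite -[X in measurable X]setTI.
  by apply: measurable_tnth => //; exact: measurable_cell.
by apply/seteqP; split=> [t tA i _|t tA i]; [exact: tA|exact: (tA i)].
Qed.

Lemma measurable_grid_step M (A : levels M -> R) :
  measurable_fun [set: n.-tuple R] (grid_step A).
Proof.
apply: measurable_sum => m; apply: measurable_funM => //.
by apply: measurable_indic; exact: measurable_box.
Qed.

Lemma grid_step_ge0 M (A : levels M -> R) t :
  (forall m, 0 <= A m) -> 0 <= grid_step A t.
Proof.
move=> A0; apply: sumr_ge0 => m _; rewrite mulr_ge0// mulr_ge0//.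
by apply: prodr_ge0 => i _; exact: density_ratio_ge0.
Qed.

Lemma integral_grid_step M (A : levels M -> R) : (0 < M)%N -> (forall m, 0 <= A m) ->
  (\int[gaussn]_t (grid_step A t)%:E = (grid_mean A)%:E)%E.
Proof.
move=> M0 A0.
have c0 m : 0 <= A m * \prod_i density_ratio M (m i).
  by rewrite mulr_ge0// prodr_ge0// => i _; exact: density_ratio_ge0.
under eq_integral => t _ do rewrite /grid_step -sumEFin.
rewrite ge0_integral_sum//=; last 2 first.
- move=> m; apply/measurable_EFinP; apply: measurable_funM => //.
  by apply: measurable_indic; exact: measurable_box.
- by move=> m t _; rewrite lee_fin mulr_ge0.
rewrite /grid_mean -sumEFin; apply: eq_bigr => m _.
under eq_integral => t _ do rewrite EFinM.
rewrite ge0_integralZl//=; last 2 first.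
- by apply/measurable_EFinP; apply: measurable_indic; exact: measurable_box.
- by rewrite lee_fin.
rewrite integral_indic//=; last exact: measurable_box.
have gbox : gaussn (box m) = (\prod_i (cell_mass M (m i))%:E)%E.
  transitivity (\prod_i gauss (cell M (m i)))%E.
    by apply: power_probability_box => i; exact: measurable_cell.
  by apply: eq_bigr => i _; rewrite cell_massE.
rewrite setIT [X in (_ * X)%E]gbox prodEFin -EFinM; congr (_%:E); rewrite -mulrA mulrC; congr (_ * _).
rewrite -big_split/=; apply: eq_bigr => i _.
by rewrite /density_ratio divfK// gt_eqF// cell_mass_gt0.
Qed.

(** The default value of [inord] in [level_of] is met only at points outside the
range of the grid, and the grid contains any given [t] in its range for
large [k]. *)
Lemma near_level t : \forall k \near \oo, forall i,
  level_of k t i = cell_index k.+1 (tnth t i) :> nat /\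
  cell k.+1 (level_of k t i) (tnth t i).
Proof.
have : \forall k \near \oo, forall i : 'I_n,
    cell k.+1 (cell_index k.+1 (tnth t i)) (tnth t i) /\
    (cell_index k.+1 (tnth t i) <= (mid_level k.+1).*2)%N.
  by apply: filter_forall => i; exact: near_cell.
apply: filterS => k h i; have [ci ki] := h i.
have lv : level_of k t i = cell_index k.+1 (tnth t i) :> nat.
  by rewrite ffunE inordK.
by rewrite lv.
Qed.

Lemma near_grid_step (A : forall k, levels k.+1 -> R) t : \forall k \near \oo,
  grid_step (A k) t =
  A k (level_of k t) * \prod_i density_ratio k.+1 (cell_index k.+1 (tnth t i)).
Proof.
apply: filterS (near_level t) => k h.
rewrite /grid_step (bigD1 (level_of k t))//= [X in _ + X]big1 => [|m ml].
  rewrite addr0 indicE mem_set ?mulr1; last by move=> i; case: (h i).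
  by congr (_ * _); apply: eq_bigr => i _; case: (h i) => ->.
rewrite indicE memNset ?mulr0// => mt.
case/eqP: ml; apply/ffunP => i; apply/val_inj => /=; have [-> _] := h i.
by have := mt i => /(cellE _ _ (ltn0Sn k))/andP[_ /eqP].
Qed.

Lemma cvg_grid_step (A : forall k, levels k.+1 -> R) t (l : R) :
  A k (level_of k t) @[k --> \oo] --> l ->
  grid_step (A k) t @[k --> \oo] --> l.
Proof.
move=> Al.
have h : A k (level_of k t) * \prod_i density_ratio k.+1 (cell_index k.+1 (tnth t i)) @[k --> \oo] --> l.
  rewrite -[X in _ --> X]mulr1; apply: cvgM => //.
  rewrite [X in _ --> X](_ : 1 = \prod_(i < n) 1 :> R); last by rewrite big1.
  apply: (@cvg_big R 'I_n *%R 1 xpredT (@mul_continuous _) nat \oo (index_enum 'I_n)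
    (fun i k => density_ratio k.+1 (cell_index k.+1 (tnth t i))) (fun=> 1)).
  by move=> i _; exact: cvg_density_ratio.
apply: (cvg_trans _ h); apply: near_eq_cvg.
by apply: filterS (near_grid_step A t) => k ->.
Qed.

(** The Gaussian integral of a step function is exactly its binomial mean, and the
step functions converge pointwise, so Fatou's lemma compares the limit with
the means and no dominating function in dimension [n] has to be found. The
measurability of the limit for the product sigma-algebra comes with it. *)
Lemma grid_fatou (A : forall k, levels k.+1 -> R) (l : n.-tuple R -> R) :
  (forall k m, 0 <= A k m) ->
  (forall t, A k (level_of k t) @[k --> \oo] --> l t) ->
  measurable_fun [set: n.-tuple R] l /\
  (\int[gaussn]_t (l t)%:E <= limn_einf (fun k => (grid_mean (A k))%:E))%E.
Proof.
move=> A0 Al; have hl t := cvg_grid_step (Al t).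
split.
  apply: (measurable_fun_cvg (h := fun k => grid_step (A k))) => //.
  by move=> k; exact: measurable_grid_step.
rewrite (_ : (fun k => _) = (fun k => \int[gaussn]_t (grid_step (A k) t)%:E)%E); last first.
  by apply/funext => k; rewrite integral_grid_step.
rewrite (_ : (\int[gaussn]_t _ = \int[gaussn]_t limn_einf (fun k => (grid_step (A k) t)%:E))%E); last first.
  apply: eq_integral => t _; apply/esym.
  apply: (cvg_limn_einf_sup _).1.
  by apply/fine_cvgP; split; [exact: nearW|exact: hl].
apply: (@fatou _ _ _ gaussn setT measurableT (fun k t => (grid_step (A k) t)%:E)) => //.
- by move=> k; apply/measurable_EFinP; exact: measurable_grid_step.
- by move=> k t _; rewrite lee_fin grid_step_ge0.
Qed.

Lemma limn_einf_near (u : nat -> R) (a b : R) : b < a ->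
  (a%:E <= limn_einf (EFin \o u))%E -> \forall k \near \oo, b <= u k.
Proof.
move=> ba; rewrite limn_einf_lim => al; apply: contrapT => nb.
suff : (limn (einfs (EFin \o u)) <= b%:E)%E.
  by move=> /(le_trans al); rewrite lee_fin leNgt ba.
apply: lime_le; first exact: is_cvg_einfs.
apply: nearW => N.
have [k Nk ukb] : exists2 k, (N <= k)%N & u k < b.
  apply: contrapT => h; apply: nb; exists N => // k /= Nk.
  by rewrite leNgt; apply/negP => ukb; apply: h; exists k.
apply: (@le_trans _ _ (u k)%:E); last by rewrite lee_fin ltW.
by apply: ereal_inf_lbound; exists k.
Qed.

End grid.

(** * The cube inequality read on the grid *)

Section grid_functions.
Local Open Scope classical_set_scope.
Local Open Scope ring_scope.
Context {R : realType} {n : nat}.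

Definition grid_point M (m : @levels n M) : 'rV[R]_n :=
  \row_i (offset M (m i) / M%:R).

Definition step_down M (h : 'rV[R]_n -> R) (i : 'I_n) (y : 'rV[R]_n) : R :=
  h y - h (y - M%:R^-1 *: delta_mx 0 i).

(** A backward difference quotient of [h], with weight m_i / (2 M ^ 2) tending to
1: the factor m_i counts the flips of coordinate [i] that show heads and
whose reversal moves the grid point down by 1 / M. *)
Definition grid_slope M (h : 'rV[R]_n -> R) i (m : levels M) : R :=
  (m i)%:R / (2 * M%:R) * step_down M h i (grid_point m).

End grid_functions.
Arguments grid_slope {R n} M h i m.
Arguments grid_point {R n M} m.

Section counts.
Local Open Scope classical_set_scope.
Local Open Scope ring_scope.
Context {R : realType} {n : nat}.
Variable M : nat.
Hypothesis M0 : (0 < M)%N.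
Local Notation N := (mid_level M).*2.
Local Notation bits := ('I_n * 'I_N)%type.
Local Notation cube := {ffun bits -> bool}.
Implicit Types (x : cube) (i : 'I_n) (k : 'I_N) (m : @levels n M).

Definition heads x i : {set 'I_N} := [set k | x (i, k)].
Definition counts x : @levels n M := [ffun i => inord #|heads x i|].

Lemma countsE x i : counts x i = #|heads x i| :> nat.
Proof.
by rewrite ffunE inordK// ltnS (leq_trans (max_card _))// card_ord.
Qed.

(** Choosing the sets of heads independently in each block, exactly
prod_i 'C(N, m_i) outcomes have the numbers of heads [m]. *)
Lemma Ex_counts (A : @levels n M -> R) : Ex (fun x => A (counts x)) = grid_mean A.
Proof.
pose uncurry (h : {ffun 'I_n -> {set 'I_N}}) : cube := [ffun u => u.2 \in h u.1].
have uncurry_bij : bijective uncurry.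
  exists (fun x => [ffun i => heads x i]) => [h|x].
    by apply/ffunP => i; rewrite ffunE; apply/setP => k; rewrite inE ffunE.
  by apply/ffunP => -[i k]; rewrite !ffunE/= inE.
have size0 (S : {set 'I_N}) : (#|S| < N.+1)%N.
  by rewrite ltnS (leq_trans (max_card _))// card_ord.
rewrite /Ex (reindex uncurry)/=; last exact: onW_bij.
have cu h i : counts (uncurry h) i = #|h i| :> nat.
  by rewrite countsE; apply: eq_card => k; rewrite inE ffunE.
rewrite (partition_big (fun h => counts (uncurry h)) xpredT)//=.
rewrite /grid_mean mulr_sumr; apply: eq_bigr => m _.
rewrite (eq_bigr (fun=> A m)); last by move=> h /eqP ->.
rewrite sumr_const -[X in _ * X]mulr_natl mulrA; congr (_ * _).
have -> : #|[pred h | counts (uncurry h) == m]|%:R =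
    \sum_(h : {ffun 'I_n -> {set 'I_N}}) \prod_i (#|h i| == m i)%:R :> R.
  rewrite -sum1_card natr_sum big_mkcond/=; apply: eq_bigr => h _.
  rewrite inE -natr_prod; case: eqP => [<-|hm].
    by rewrite big1// => i _; rewrite cu eqxx.
  have [i mi] : exists i, #|h i| != m i.
    apply/existsP; apply: contra_notT hm; rewrite negb_exists => /forallP hm.
    apply/ffunP => i; apply/val_inj; rewrite /= cu; apply/eqP.
    by have := hm i; rewrite negbK.
  by rewrite (bigD1 i)//= (negbTE mi) mul0n.
rewrite -(bigA_distr_bigA (fun i (S : {set 'I_N}) => (#|S| == m i)%:R : R))/=.
rewrite card_prod !card_ord mulnC exprM -[in X in _ ^+ X](card_ord n) -prodr_const -prodfV -big_split/=.
apply: eq_bigr => i _; rewrite /binomial_weight mulrC; congr (_ / _).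
rewrite -natr_sum; congr (_%:R).
have := card_draws 'I_N (m i); rewrite card_ord => <-.
rewrite -sum1_card [RHS]big_mkcond/=.
by apply: eq_bigr => S _; rewrite inE; case: eqP.
Qed.

Lemma counts_flip x i k : x (i, k) ->
  grid_point (counts (flip (i, k) x)) =
  grid_point (counts x) - M%:R^-1 *: delta_mx 0 i :> 'rV[R]_n.
Proof.
move=> xik; have M0' : M%:R != 0 :> R by rewrite pnatr_eq0 -lt0n.
apply/rowP => j; rewrite !mxE /offset !countsE eqxx/=.
have [->|ji] := eqVneq j i.
  have -> : #|heads x i| = #|heads (flip (i, k) x) i|.+1.
    rewrite (cardsD1 k) inE xik add1n; congr _.+1; apply: eq_card => l.
    rewrite !inE ffunE xpair_eqE eqxx/=.
    by have [->|] := eqVneq l k; rewrite ?xik.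
  by rewrite -[X in _ = (X - _) / _ - _]natr1 mulr1n; field.
rewrite mulr0 subr0; congr ((_%:R - _) / _); apply: eq_card => l.
by rewrite !inE ffunE xpair_eqE (negbTE ji).
Qed.

Lemma step_down_ge0 (h : 'rV[R]_n -> R) i y :
  coordinatewise_nondecreasing h -> 0 <= step_down M h i y.
Proof.
move=> hm; rewrite /step_down subr_ge0; apply: (hm i) => [j ji|]; rewrite !mxE.
  by rewrite (negbTE ji) andbF mulr0 subr0.
by rewrite gerBl !eqxx mulr1 invr_ge0.
Qed.

Lemma grid_slope_ge0 (h : 'rV[R]_n -> R) i m :
  coordinatewise_nondecreasing h -> 0 <= grid_slope M h i m.
Proof. by move=> hm; rewrite mulr_ge0 ?divr_ge0 ?step_down_ge0. Qed.

Let lift (h : 'rV[R]_n -> R) x : R := h (grid_point (counts x)).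

Lemma lift_admissible (h : 'rV[R]_n -> R) :
  (forall y, -1 <= h y <= 1) -> coordinatewise_nondecreasing h ->
  cube_admissible (lift h).
Proof.
move=> h1 hm; split=> [x|[i k] x]; first by rewrite ler_norml h1.
rewrite /cube_partial divr_ge0//; case: (boolP (x (i, k))) => xik; rewrite /sgn.
  by rewrite mul1r /lift (counts_flip xik) step_down_ge0.
have yik : flip (i, k) x (i, k) by rewrite flipE.
have := counts_flip yik; rewrite flipK => e.
by rewrite mulN1r opprB /lift e step_down_ge0.
Qed.

Lemma fourier_lift_swap (h : 'rV[R]_n -> R) i k l :
  fourier (lift h) [set (i, k)]%SET = fourier (lift h) [set (i, l)]%SET.
Proof.
pose s : bits -> bits := tperm (i, k) (i, l).
pose swap x : cube := [ffun u => x (s u)].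
have swapK : involutive swap by move=> x; apply/ffunP => u; rewrite !ffunE /s tpermK.
rewrite /fourier /Ex; congr (_ * _); rewrite [RHS](reindex_inj (inv_inj swapK))/=.
apply: eq_bigr => x _; rewrite !walsh1 ffunE /s tpermR; congr (_ * _).
rewrite /lift; congr (h (grid_point _)); apply/ffunP => j; apply/val_inj => /=.
rewrite !countsE.
have [->|ji] := eqVneq j i; last first.
  apply: eq_card => r; rewrite !inE ffunE /s tpermD// xpair_eqE negb_and eq_sym ji//.
have -> : heads (swap x) i = (tperm k l @^-1: heads x i)%SET.
  apply/setP => r; rewrite !inE ffunE /s; congr (x _).
  have [->|rk] := eqVneq r k; first by rewrite !tpermL.
  have [->|rl] := eqVneq r l; first by rewrite !tpermR.
  by rewrite !tpermD// ?xpair_eqE ?eqxx//= eq_sym.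
by rewrite [RHS](card_preimset _ (@perm_inj _ (tperm k l))).
Qed.

(** Reversing the flip pairs each outcome showing heads at (i, k) with one showing
tails, so the coefficient is the mean of the decrease of [h] over outcomes with
heads; the sum over [k] counts the heads. *)
Lemma sum_fourier_lift (h : 'rV[R]_n -> R) i :
  \sum_k fourier (lift h) [set (i, k)]%SET = 2 * M%:R * grid_mean (grid_slope M h i).
Proof.
have M0' : M%:R != 0 :> R by rewrite pnatr_eq0 -lt0n.
have fE k : fourier (lift h) [set (i, k)]%SET =
    Ex (fun x : cube => (x (i, k))%:R * step_down M h i (grid_point (counts x))).
  have -> : fourier (lift h) [set (i, k)]%SET =
     Ex (fun x : cube => (x (i, k))%:R * lift h x) +
     - Ex (fun x : cube => (~~ x (i, k))%:R * lift h x).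
    rewrite -ExN -ExD; apply: eq_Ex => x; rewrite walsh1.
    by case: (x (i, k)); rewrite /= mulr1n mulr0n; ring.
  rewrite -[X in - X](Ex_flip (i, k)) -ExN -ExD; apply: eq_Ex => x.
  rewrite flipE negbK /step_down /lift.
  by case: (boolP (x (i, k))) => [/counts_flip ->|_]; rewrite ?mulr1n ?mulr0n; ring.
rewrite (eq_bigr _ (fun k _ => fE k)) -Ex_sum -Ex_counts -ExZ.
apply: eq_Ex => x; rewrite -mulr_suml -natr_sum /grid_slope countsE mulrA; congr (_ * _).
have -> : (\sum_(k < N) x (i, k) = #|heads x i|)%N.
  by rewrite -sum1_card [RHS]big_mkcond/=; apply: eq_bigr => k _; rewrite inE; case: (x _).
by field.
Qed.

(** By symmetry the 4 M ^ 2 coefficients of block [i] coincide, and each equals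
grid_mean (grid_slope M h i) / (2 M); the product of two of these times the
block size has no factor left. *)
Lemma level1_lift (f g : 'rV[R]_n -> R) :
  level1 (lift f) (lift g) =
  \sum_i grid_mean (grid_slope M f i) * grid_mean (grid_slope M g i).
Proof.
have M0' : M%:R != 0 :> R by rewrite pnatr_eq0 -lt0n.
have N0 : (0 < N)%N by rewrite double_gt0 /mid_level muln_gt0 expn_gt0 M0.
have NE : N%:R = 4 * M%:R ^+ 2 :> R by rewrite -addnn natrD mid_levelE; ring.
have fE (h : 'rV[R]_n -> R) i k : fourier (lift h) [set (i, k)]%SET = grid_mean (grid_slope M h i) / (2 * M%:R).
  have := sum_fourier_lift h i.
  rewrite (eq_bigr _ (fun l _ => fourier_lift_swap h i l k)) sumr_const card_ord.
  rewrite -[X in X = _ -> _]mulr_natr NE => e.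
  apply: (mulIf (_ : 4 * M%:R ^+ 2 != 0)); first by rewrite mulf_neq0// expf_neq0.
  by rewrite e; field.
pose c i := grid_mean (grid_slope M f i) / (2 * M%:R) *
  (grid_mean (grid_slope M g i) / (2 * M%:R)).
rewrite /level1 (eq_bigr (fun t : bits => c t.1)); last first.
  by move=> [i k] _; rewrite !fE.
rewrite -(pair_big xpredT xpredT (fun i (_ : 'I_N) => c i))/=.
apply: eq_bigr => i _; rewrite sumr_const card_ord -[LHS]mulr_natr NE.
by rewrite /c; field.
Qed.

Lemma grid_correlation (f g : 'rV[R]_n -> R) :
  (forall y, -1 <= f y <= 1) -> (forall y, -1 <= g y <= 1) ->
  coordinatewise_nondecreasing f -> coordinatewise_nondecreasing g ->
  let W := \sum_i grid_mean (grid_slope M f i) * grid_mean (grid_slope M g i) in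
  let cov := grid_mean (fun m : levels M => f (grid_point m) * g (grid_point m)) -
    grid_mean (fun m : levels M => f (grid_point m)) *
    grid_mean (fun m : levels M => g (grid_point m)) in
  [/\ 0 <= cov, W <= 1 &
      forall V, 0 < V -> V <= W -> V / (288 * ln (expR 1 / V)) <= cov].
Proof.
move=> f1 g1 fm gm; have af := lift_admissible f1 fm; have ag := lift_admissible g1 gm.
rewrite /= -level1_lift.
rewrite -(Ex_counts (fun m => f (grid_point m) * g (grid_point m))).
rewrite -(Ex_counts (fun m : levels M => f (grid_point m))) -(Ex_counts (fun m : levels M => g (grid_point m))).
split; [exact: (cube_harris af ag)|exact: level1_le1|].
exact: (cube_correlation af ag).
Qed.

End counts.

(** * Limits of grid points and slopes *)

Section limits.
Local Open Scope classical_set_scope.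
Local Open Scope ring_scope.
Context {R : realType} {n : nat}.
Implicit Types (t : n.-tuple R) (k : nat) (h : 'rV[R]_n -> R) (i : 'I_n) (y : 'rV[R]_n).

Lemma row_norm_le y (e : R) : 0 <= e -> (forall i, `|y 0 i| <= e) -> `|y| <= e.
Proof.
move=> e0 ye; rewrite [leLHS]mx_normrE; apply: bigmax_le => // -[i j] _ /=.
by rewrite (ord1 i).
Qed.

Lemma cvg_grid_point t :
  grid_point (level_of k t) @[k --> \oo] --> (\row_i tnth t i : 'rV[R]_n).
Proof.
apply/cvgrPdist_le => e e0; near=> k.
have h : forall i, level_of k t i = cell_index k.+1 (tnth t i) :> nat /\
  cell k.+1 (level_of k t i) (tnth t i) by near: k; exact: near_level.
apply: row_norm_le => [|i]; first exact: ltW.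
rewrite !mxE; have [_ ci] := h i.
apply: (le_trans (cell_offset (ltn0Sn k) ci)).
near: k; have /cvgrPdist_le/(_ _ e0) := @cvg_invS R.
apply: filterS => k; rewrite sub0r normrN; apply: le_trans; exact: ler_norm.
Unshelve. all: by end_near. Qed.

Lemma partial_mean_value h i y (d : R) : (forall x, differentiable h x) -> 0 <= d ->
  exists2 s, 0 <= s <= d & h y - h (y - d *: delta_mx 0 i) =
    partial i h (y - s *: delta_mx 0 i) * d.
Proof.
move=> dh d0.
pose e : 'rV[R]_n := delta_mx 0 i.
pose p (r : R) := h (r *: e + y).
have dp (r : R) : is_derive r 1 p (partial i h (r *: e + y)).
  have E : (fun a : R => a^-1 *: ((p \o shift r) (a *: 1) - p r)) =
      (fun a : R => a^-1 *: ((h \o shift (r *: e + y)) (a *: e) - h (r *: e + y))).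
    apply/funext => a; rewrite /p /=; congr (_ *: (h _ - _)).
    by rewrite -mulr_algl mulr1 [a%:A]mulr1 scalerDl addrA.
  apply: DeriveDef; last by rewrite /partial /derive E.
  by rewrite /derivable E; apply: diff_derivable.
have d0' : - d <= 0 by rewrite oppr_le0.
have cp : {within `[- d, 0], continuous p}.
  by apply: derivable_within_continuous => r _; case: (dp r).
have [c] := MVT_segment d0' (fun r _ => dp r) cp.
rewrite in_itv/= => /andP[c1 c2] hc; exists (- c).
  by apply/andP; split; lra.
move: hc; rewrite /p scale0r add0r sub0r !scaleNr !opprK.
by rewrite [in h (- _ + _)]addrC [c *: e + y]addrC.
Qed.

(** The mean value theorem along coordinate [i] replaces the difference quotient
by the partial derivative at a point within 1 / M of the grid point, and
continuity of the derivative gives the limit. *)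
Lemma cvg_grid_slope h i t : continuously_differentiable h ->
  grid_slope k.+1 h i (level_of k t) @[k --> \oo] --> partial i h (\row_i tnth t i).
Proof.
move=> [dh ch].
set x : 'rV[R]_n := \row_i tnth t i.
pose q k : R := step_down k.+1 h i (grid_point (level_of k t)) * k.+1%:R.
have cq : q k @[k --> \oo] --> partial i h x.
  apply/cvgrPdist_le => e e0.
  have /cvgrPdist_le/(_ _ e0)/nbhs_ballP[d /= d0 dP] := ch i x.
  have d20 : 0 < d / 2 by rewrite divr_gt0.
  have /cvgrPdist_lt/(_ _ d20) cy := @cvg_grid_point t.
  have /cvgrPdist_lt/(_ _ d20) c0 := @cvg_invS R.
  near=> k.
  have hk : `|x - grid_point (level_of k t)| < d / 2 by near: k; exact: cy.
  have hk' : k.+1%:R^-1 < d / 2.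
    have : `|0 - k.+1%:R^-1 : R| < d / 2 by near: k; exact: c0.
    by rewrite sub0r normrN; apply: le_lt_trans; exact: ler_norm.
  have k0 : 0 < k.+1%:R :> R by rewrite ltr0n.
  have k0' : 0 <= k.+1%:R^-1 :> R by rewrite invr_ge0 ltW.
  have [s /andP[s0 s1]] := partial_mean_value i (grid_point (level_of k t)) dh k0'.
  rewrite /q /step_down => ->; rewrite divfK ?gt_eqF//.
  apply: dP; rewrite -ball_normE /ball_/=.
  rewrite opprB addrA addrAC.
  apply: (le_lt_trans (ler_normD _ _)).
  rewrite [ltRHS](splitr d); apply: ltrD => //.
  apply: le_lt_trans hk'; apply: row_norm_le => // j.
  rewrite !mxE eqxx/= normrM ger0_norm//; apply: le_trans s1.
  by rewrite ler_piMr//; case: eqP; rewrite ?normr1 ?normr0.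
have cm : (level_of k t i)%:R / (2 * k.+1%:R ^+ 2) @[k --> \oo] --> (1 : R).
  have h1 : 1 + offset k.+1 (cell_index k.+1 (tnth t i)) / k.+1%:R * k.+1%:R^-1 / 2 @[k --> \oo] --> (1 : R).
    rewrite -[X in _ --> X]addr0; apply: cvgD; first exact: cvg_cst.
    rewrite -[X in _ --> X](mul0r (2^-1)); apply: cvgM; last exact: cvg_cst.
    rewrite -[X in _ --> X](mulr0 (tnth t i)); apply: cvgM; last exact: cvg_invS.
    exact: cvg_position.
  apply: (cvg_trans _ h1); apply: near_eq_cvg.
  apply: filterS (near_level t) => k hk; have [-> _] := hk i.
  rewrite /offset mid_levelE; field; rewrite addrC natr1 pnatr_eq0//.
have h2 : (level_of k t i)%:R / (2 * k.+1%:R ^+ 2) * q k @[k --> \oo] --> partial i h x.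
  by rewrite -[X in _ --> X]mul1r; exact: cvgM.
apply: (cvg_trans _ h2); apply: near_eq_cvg.
apply: nearW => k; rewrite /grid_slope /q.
by field; rewrite addrC natr1 pnatr_eq0.
Unshelve. all: by end_near. Qed.

End limits.

(** * Transfer to Gaussian space *)

Section transfer.
Local Open Scope classical_set_scope.
Local Open Scope ring_scope.
Context {R : realType} {n : nat}.
Local Notation gauss := (normal_prob (0 : R) 1).
Local Notation gaussn := (power_probability gauss n).
Implicit Types (t : n.-tuple R) (k : nat) (h : 'rV[R]_n -> R) (i : 'I_n).

Definition grid_expectation k h : R :=
  grid_mean (fun m : levels k.+1 => h (grid_point m)).

Lemma grid_expectationD1 k h :
  grid_expectation k (fun x => 1 + h x) = 1 + grid_expectation k h.
Proof.
rewrite /grid_expectation -(Ex_counts (fun m : levels k.+1 => 1 + h (grid_point m))).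
by rewrite ExD Ex_cst (Ex_counts (fun m : levels k.+1 => h (grid_point m))).
Qed.

Lemma grid_expectationN k h :
  grid_expectation k (fun x => - h x) = - grid_expectation k h.
Proof.
rewrite /grid_expectation /grid_mean -sumrN; apply: eq_bigr => m _.
by rewrite mulrN.
Qed.

Lemma cvg_on_grid h t : continuous h ->
  h (grid_point (level_of k t)) @[k --> \oo] --> h (\row_i tnth t i).
Proof. by move=> ch; apply: (cvg_comp _ h); [exact: cvg_grid_point|exact: ch]. Qed.

Lemma continuous_row_measurable h : (forall x, -1 <= h x <= 1) -> continuous h ->
  measurable_fun [set: n.-tuple R] (fun t => h (\row_i tnth t i)).
Proof.
move=> h1 ch.
have [||m1 _] := @grid_fatou R n (fun k m => 1 + h (grid_point m)) (fun t => 1 + h (\row_i tnth t i)).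
- by move=> k m; have /andP[] := h1 (grid_point m); lra.
- by move=> t; apply: cvgD; [exact: cvg_cst|exact: cvg_on_grid].
rewrite (_ : (fun t => _) = (fun t : n.-tuple R => (1 + h (\row_i tnth t i)) - 1)).
  exact: measurable_funB.
by apply/funext => t; rewrite addrAC subrr add0r.
Qed.

Lemma bounded_row_integrable h : (forall x, -1 <= h x <= 1) -> continuous h ->
  gaussn.-integrable [set: n.-tuple R] (fun t => (h (\row_i tnth t i))%:E).
Proof.
move=> h1 ch; have mh := continuous_row_measurable h1 ch.
apply: measurable_bounded_integrable => //.
  by rewrite ltey_eq fin_num_measure.
exists 1; split => // M M1 t _ /=; apply: (le_trans _ (ltW M1)).
by rewrite ler_norml h1.
Qed.

Lemma gauss_expectationN h : (forall x, -1 <= h x <= 1) -> continuous h ->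
  gauss_expectation (fun x => - h x) = - gauss_expectation h.
Proof.
move=> h1 ch; have ih := bounded_row_integrable h1 ch.
rewrite /gauss_expectation /Rintegral -fineN; congr fine.
by rewrite -integralN ?integrable_add_def//; apply: eq_integral => t _; rewrite EFinN.
Qed.

Lemma gauss_expectation_lower h (e : R) :
  (forall x, -1 <= h x <= 1) -> continuous h -> 0 < e ->
  \forall k \near \oo, gauss_expectation h - e <= grid_expectation k h.
Proof.
move=> h1 ch e0; have ih := bounded_row_integrable h1 ch.
have [||_ le] := @grid_fatou R n (fun k m => 1 + h (grid_point m)) (fun t => 1 + h (\row_i tnth t i)).
- by move=> k m; have /andP[] := h1 (grid_point m); lra.
- by move=> t; apply: cvgD; [exact: cvg_cst|exact: cvg_on_grid].
have E : (\int[gaussn]_t (1 + h (\row_i tnth t i))%:E = (1 + gauss_expectation h)%:E)%E.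
  under eq_integral => t _ do rewrite EFinD.
  rewrite integralD//=; last first.
    apply: measurable_bounded_integrable => //.
      by rewrite ltey_eq fin_num_measure.
    by exists 1; split => // M M1 t _ /=; rewrite normr1 ltW.
  rewrite integral_cst// [X in (_ * X)%E](probability_setT gaussn) mule1 EFinD; congr (_ + _)%E.
  by rewrite /gauss_expectation /Rintegral fineK// integrable_fin_num.
rewrite E in le.
have := limn_einf_near (_ : 1 + gauss_expectation h - e < 1 + gauss_expectation h) le.
rewrite gtrBl => /(_ e0); apply: filterS => k.
by rewrite -/(grid_expectation k (fun x => 1 + h x)) grid_expectationD1 -addrA lerD2l.
Qed.

(** [grid_fatou] bounds the liminf from below for both 1 + h and 1 - h; as the
total mass is 1 on both sides, the two bounds force convergence. *)
Lemma cvg_grid_expectation h : (forall x, -1 <= h x <= 1) -> continuous h ->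
  grid_expectation k h @[k --> \oo] --> gauss_expectation h.
Proof.
move=> h1 ch; apply/cvgrPdist_le => e e0.
have h1' x : -1 <= - h x <= 1 by have /andP[] := h1 x; move=> *; apply/andP; split; lra.
have ch' : continuous (fun x => - h x) by move=> x; apply: continuousN; exact: ch.
have L := gauss_expectation_lower h1 ch e0.
have U := gauss_expectation_lower h1' ch' e0.
near=> k.
have l1 : gauss_expectation h - e <= grid_expectation k h by near: k.
have l2 : gauss_expectation (fun x => - h x) - e <= grid_expectation k (fun x => - h x) by near: k.
rewrite gauss_expectationN// grid_expectationN in l2.
by rewrite ler_norml; apply/andP; split; lra.
Unshelve. all: by end_near. Qed.

Lemma partial_row_ge0 h i t :
  coordinatewise_nondecreasing h -> continuously_differentiable h ->
  0 <= partial i h (\row_i tnth t i).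
Proof.
move=> hm hd; have := @cvg_grid_slope R n h i t hd.
move=> c; apply: (cvgr_to_ge c); apply: nearW => k; exact: grid_slope_ge0.
Qed.

(** If the Gaussian integral of the partial derivative is infinite, its real value
is 0 by convention and the lower bound is trivial. *)
Lemma gauss_partial_lower h i (s : R) : coordinatewise_nondecreasing h ->
  continuously_differentiable h -> s < 1 ->
  0 <= gauss_expectation (partial i h) /\
  \forall k \near \oo,
    s * gauss_expectation (partial i h) <= grid_mean (grid_slope k.+1 h i).
Proof.
move=> hm hd s1.
have [||_ le] := @grid_fatou R n (fun k m => grid_slope k.+1 h i m) (fun t => partial i h (\row_i tnth t i)).
- by move=> k m; exact: grid_slope_ge0.
- by move=> t; exact: cvg_grid_slope.
have J0 : (0 <= \int[gaussn]_t (partial i h (\row_i tnth t i))%:E)%E.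
  by apply: integral_ge0 => t _; rewrite lee_fin partial_row_ge0.
rewrite /gauss_expectation /Rintegral; move: le J0; case: (integral _ _ _) => [a| |]//= le.
- rewrite lee_fin => a0; split=> //.
  move: a0; rewrite le_eqVlt => /predU1P[<-|a0].
    apply: nearW => k; rewrite mulr0; apply: sumr_ge0 => m _.
    by rewrite mulr_ge0 ?grid_slope_ge0// prodr_ge0// => j _; exact: binomial_weight_ge0.
  by apply: limn_einf_near le; rewrite gtr_pMl.
- move=> _; split=> //.
  apply: nearW => k; rewrite mulr0; apply: sumr_ge0 => m _.
  by rewrite mulr_ge0 ?grid_slope_ge0// prodr_ge0// => j _; exact: binomial_weight_ge0.
Qed.


Definition gauss_level1 (f g : 'rV[R]_n -> R) : R :=
  \sum_(i < n) gauss_expectation (partial i f) * gauss_expectation (partial i g).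

Section two_functions.
Variables f g : 'rV[R]_n -> R.
Hypotheses (f1 : forall x, -1 <= f x <= 1) (g1 : forall x, -1 <= g x <= 1).
Hypotheses (fm : coordinatewise_nondecreasing f)
  (gm : coordinatewise_nondecreasing g).
Hypotheses (df : continuously_differentiable f)
  (dg : continuously_differentiable g).

Let grid_level1 k : R :=
  \sum_i grid_mean (grid_slope k.+1 f i) * grid_mean (grid_slope k.+1 g i).
Let grid_cov k : R := grid_expectation k (fun x => f x * g x) -
  grid_expectation k f * grid_expectation k g.
Let gauss_cov : R := gauss_expectation (fun x => f x * g x) -
  gauss_expectation f * gauss_expectation g.

Lemma cvg_grid_cov : grid_cov k @[k --> \oo] --> gauss_cov.
Proof.
have cf : continuous f by move=> x; apply: differentiable_continuous; exact: df.1.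
have cg : continuous g by move=> x; apply: differentiable_continuous; exact: dg.1.
apply: cvgB.
  apply: cvg_grid_expectation; last first.
    by move=> x; apply: continuousM; [exact: cf|exact: cg].
  by move=> x; rewrite -ler_norml normrM mulr_ile1// ler_norml.
by apply: cvgM; exact: cvg_grid_expectation.
Qed.

Lemma gauss_level1_ge0 : 0 <= gauss_level1 f g.
Proof.
apply: sumr_ge0 => i _; apply: mulr_ge0.
  by have [] := gauss_partial_lower i fm df (ltr01 : (0 : R) < 1).
by have [] := gauss_partial_lower i gm dg (ltr01 : (0 : R) < 1).
Qed.

Lemma near_grid_level1 (s : R) : 0 <= s -> s < 1 ->
  \forall k \near \oo, s ^+ 2 * gauss_level1 f g <= grid_level1 k.
Proof.
move=> s0 s1.
have H : \forall k \near \oo, forall i : 'I_n,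
    s * gauss_expectation (partial i f) <= grid_mean (grid_slope k.+1 f i) /\
    s * gauss_expectation (partial i g) <= grid_mean (grid_slope k.+1 g i).
  apply: filter_forall => i.
  have [_ A] := gauss_partial_lower i fm df s1.
  have [_ B] := gauss_partial_lower i gm dg s1.
  by near=> k; split; near: k; [exact: A|exact: B].
apply: filterS H => k H; rewrite mulr_sumr; apply: ler_sum => i _.
have [h1 h2] := H i.
have [a0 _] := gauss_partial_lower i fm df s1.
have [b0 _] := gauss_partial_lower i gm dg s1.
by rewrite expr2 mulrACA; apply: ler_pM => //; rewrite mulr_ge0.
Unshelve. all: by end_near. Qed.

(** The level-1 sums on the cube are at most 1, and they exceed s ^ 2 times the
Gaussian sum for every s < 1; s = (1 + 1 / W) / 2 gives a contradiction if
the Gaussian sum W exceeds 1. *)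
Lemma gauss_level1_le1 : gauss_level1 f g <= 1.
Proof.
rewrite leNgt; apply/negP => W1; set W := gauss_level1 f g in W1.
pose v := W^-1.
have v0 : 0 < v by rewrite invr_gt0; lra.
have v1 : v < 1 by rewrite invf_lt1//; lra.
have s0 : 0 <= (1 + v) / 2 by lra.
have s1 : (1 + v) / 2 < 1 by lra.
have [k _ /(_ k (leqnn k))] := near_grid_level1 s0 s1.
have [_ Wk _] := grid_correlation (ltn0Sn k) f1 g1 fm gm.
move=> /le_trans/(_ Wk); apply/negP; rewrite -ltNge.
have W0 : W != 0 by rewrite gt_eqF// (lt_trans ltr01 W1).
rewrite -(ltr_pM2r v0) mul1r -mulrA divff// mulr1.
have : 0 < (1 - v) ^+ 2 by rewrite exprn_gt0// subr_gt0.
lra.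
Qed.

Lemma gauss_harris : 0 <= gauss_cov.
Proof.
apply: (cvgr_to_ge cvg_grid_cov); apply: nearW => k.
by have [] := grid_correlation (ltn0Sn k) f1 g1 fm gm.
Qed.

(** Halving the level-1 sum leaves room for the factor s ^ 2 = 9 / 16 in
[near_grid_level1]. *)
Lemma gauss_correlation (V : R) : 0 < V -> V <= gauss_level1 f g / 2 ->
  V / (288 * ln (expR 1 / V)) <= gauss_cov.
Proof.
move=> V0 VW; apply: (cvgr_to_ge cvg_grid_cov).
have s0 : 0 <= 3 / 4 :> R by lra.
have s1 : 3 / 4 < 1 :> R by lra.
apply: filterS (near_grid_level1 s0 s1) => k Wk.
have [_ _] := grid_correlation (ltn0Sn k) f1 g1 fm gm; apply => //.
by apply: le_trans Wk; have := gauss_level1_ge0; lra.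
Qed.

End two_functions.
End transfer.

Theorem theorem2p1 (R : realType) :
  exists2 c : R, 0 < c &
    forall (n : nat) (f g : 'rV[R]_n -> R),
      (1 <= n)%N ->
      (forall x, -1 <= f x <= 1) ->
      (forall x, -1 <= g x <= 1) ->
      coordinatewise_nondecreasing f ->
      coordinatewise_nondecreasing g ->
      continuously_differentiable f ->
      continuously_differentiable g ->
      gauss_expectation (fun x => f x * g x)
        - gauss_expectation f * gauss_expectation g
      >= c * phi (\sum_(i < n) gauss_expectation (partial i f)
                               * gauss_expectation (partial i g)).
Proof.
(* One factor 2 comes from V = W / 2, the other from ln (e / V) <= 2 ln (e / W). *)
exists ((4 * 288)^-1); first by rewrite invr_gt0 mulr_gt0.
move=> n f g _ f1 g1 fm gm df dg.
rewrite -/(gauss_level1 f g) /phi; set W := gauss_level1 f g.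
have [_|Wn0] := eqVneq W 0; first by rewrite mulr0; exact: gauss_harris.
have W0 : 0 < W by rewrite lt0r Wn0; exact: gauss_level1_ge0.
have W1 : W <= 1 by exact: gauss_level1_le1.
set L := ln (expR 1 / W).
have eW0 : 0 < expR 1 / W by rewrite divr_gt0 ?expR_gt0.
have L1 : 1 <= L.
  by rewrite /L -ler_expR lnK ?posrE// ler_pdivlMr// ler_piMr ?expR_ge0.
have VE : ln (expR 1 / (W / 2)) = ln (1 + 1) + L.
  have -> : expR 1 / (W / 2) = 2 * (expR 1 / W) by field.
  by rewrite lnM ?posrE.
have ln2_gt0 : 0 < ln (1 + 1) :> R by apply: ln_gt0; lra.
have ln2_le1 : ln (1 + 1) <= 1 :> R by apply: le_ln1Dx; lra.
have W20 : 0 < W / 2 by rewrite divr_gt0.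
apply: le_trans (gauss_correlation f1 g1 fm gm df dg W20 (lexx _)).
have -> : (4 * 288)^-1 * (W / L) = (W / 2) / (288 * (2 * L)).
  by field; rewrite gt_eqF//; lra.
by rewrite VE ler_pM2l// lef_pV2 ?posrE; lra.
Qed.
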